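(* Let $G$ be a one-relator group with torsion, i.e. $G = \langle x_1, \ldots, x_k \mid R^n\rangle$ for some integer $n > 1$ and some nontrivial element $R$ of the free group on $x_1, \ldots, x_k$. Then the quotient map $\mathrm{Aut}(G) \to \mathrm{Out}(G)$ splits virtually.
   Context: For a group $G$, $\mathrm{Inn}(G)$ is the group of inner automorphisms and $\mathrm{Out}(G) = \mathrm{Aut}(G)/\mathrm{Inn}(G)$. A group epimorphism $f : A \to B$ splits virtually if there exist a finite index subgroup $B' < B$ and a homomorphism $g : B' \to A$ with $f \circ g = \mathrm{Id}_{B'}$. *)

(* Defs.v *)
From HB Require Import structures.
From mathcomp Require Import all_boot.
From mathcomp Require Import boolp classical_sets functions cardinality.

Set Implicit Arguments.
Unset Strict Implicit.
Unset Printing Implicit Defensive.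

Local Open Scope classical_set_scope.
Local Open Scope group_scope.
Local Open Scope quotient_scope.

(* Free groups: a word over X is a sequence of letters (x, e), where (x, true) *)
(* stands for x and (x, false) for x^-1; the elements of the free group are    *)
(* the reduced words.                                                          *)

Section FreeGroup.
Variable X : choiceType.
Implicit Types (a b : X * bool) (s t u : seq (X * bool)).

Definition invl a := (a.1, ~~ a.2).

Definition reduced s := sorted (fun a b => b != invl a) s.

(* consr a s and catr s t are the reduced forms of a :: s and s ++ t, for       *)
(* reduced s and t.                                                            *)
Definition consr a s :=
  if s is b :: s' then if b == invl a then s' else a :: s else [:: a].

Definition catr s t := foldr consr t s.

Definition invw s := rev (map invl s).

Lemma invlK : involutive invl.
Proof. by case=> x e; rewrite /invl /= negbK. Qed.

Lemma consr_reduced a s : reduced s -> reduced (consr a s).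
Proof.
case: s => //= b s rs; case: ifP => [_|/negbT ba]; first exact: path_sorted rs.
by rewrite /= ba.
Qed.

Lemma catr_reduced s t : reduced t -> reduced (catr s t).
Proof. by move=> rt; elim: s => //= a s; apply: consr_reduced. Qed.

Lemma consrK a s : reduced s -> consr a (consr (invl a) s) = s.
Proof.
case: s => [_|b s /=]; first by rewrite /= eqxx.
rewrite invlK; case: eqVneq => [-> {b}|nba _]; last by rewrite /= eqxx.
case: s => //= b s /andP[/negbTE ba _]; by rewrite ba.
Qed.

Lemma catr_consr a s t : reduced t -> catr (consr a s) t = consr a (catr s t).
Proof.
move=> rt; case: s => [//|b s /=]; case: eqP => // ->.
by rewrite consrK // catr_reduced.
Qed.

Lemma catrA s t u : reduced u -> catr (catr s t) u = catr s (catr t u).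
Proof. by move=> ru; elim: s => //= a s IHs; rewrite catr_consr // IHs. Qed.

Lemma catrs0 s : reduced s -> catr s [::] = s.
Proof.
elim: s => //= a s IHs rs; rewrite IHs; last exact: path_sorted rs.
by case: s rs {IHs} => //= b s /andP[/negbTE-> _].
Qed.

Lemma invwK : involutive invw.
Proof. by move=> s; rewrite /invw map_rev revK mapK //; apply: invlK. Qed.

Lemma invw_reduced s : reduced s -> reduced (invw s).
Proof.
rewrite /reduced /invw rev_sorted sorted_map; apply: sub_sorted => a b /=.
by rewrite invlK eq_sym.
Qed.

Lemma catVw s t : reduced t -> catr (invw s) (catr s t) = t.
Proof.
rewrite /invw; elim: s t => //= a s IHs t rt.
rewrite rev_cons /catr foldr_rcons -/(catr s t) -/(catr _ _).
by rewrite -{2}[a]invlK consrK ?catr_reduced ?IHs.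
Qed.

Record freeGroup := FreeGroup {fword :> seq (X * bool); _ : reduced fword}.

HB.instance Definition _ := [isSub for fword].
HB.instance Definition _ := [Choice of freeGroup by <:].

Lemma freeP (u : freeGroup) : reduced u. Proof. exact: valP. Qed.

Definition free1 : freeGroup := @FreeGroup [::] isT.
Definition freeM (u v : freeGroup) := FreeGroup (catr_reduced u (freeP v)).
Definition freeV (u : freeGroup) := FreeGroup (invw_reduced (freeP u)).

Lemma freeMA : associative freeM.
Proof. by move=> u v w; apply/val_inj; rewrite /= catrA // freeP. Qed.
Lemma free1M : left_id free1 freeM.
Proof. by move=> u; apply/val_inj. Qed.
Lemma freeM1 : right_id free1 freeM.
Proof. by move=> u; apply/val_inj; rewrite /= catrs0 // freeP. Qed.
Lemma freeVM : left_inverse free1 freeV freeM.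
Proof.
by move=> u; apply/val_inj; rewrite /= -{2}(catrs0 (freeP u)) catVw.
Qed.
Lemma freeMV : right_inverse free1 freeV freeM.
Proof.
move=> u; apply/val_inj; have := @catVw (invw u) [::] isT.
by rewrite invwK catrs0 // invw_reduced // freeP.
Qed.

HB.instance Definition _ :=
  isGroup.Build freeGroup freeMA free1M freeM1 freeVM freeMV.

End FreeGroup.

Section Subgroups.
Variable G : groupType.

Record subgroup := Subgroup {sgset :> set G; sgP : group_closed (mem sgset)}.

Definition normal_closed (N : set G) :=
  group_closed (mem N) /\ {in N, forall x y, x ^ y \in N}.

Record normal_subgroup :=
  NormalSubgroup {nsset :> set G; nsP : normal_closed nsset}.

Definition finite_index (H : subgroup) :=
  finite_set [set [set x * y | y in H] | x in [set: G]].

Definition normal_closure (S : set G) : set G := smallest normal_closed S.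

Lemma normal_closureP S : normal_closed (normal_closure S).
Proof.
split; first split.
- by apply/mem_set => N [[[N1 _] _] _]; apply: set_mem N1.
- move=> x y /set_mem Sx /set_mem Sy; apply/mem_set => N SN.
  case: (SN) => [[[_ NF] _] _]; apply/set_mem/NF; apply/mem_set.
    exact: Sx.
  exact: Sy.
- move=> x /set_mem Sx y; apply/mem_set => N SN.
  case: (SN) => [[_ NJ] _]; apply/set_mem/NJ/mem_set; exact: Sx.
Qed.

Definition ncl (S : set G) := NormalSubgroup (normal_closureP S).

Definition subgroup_type (H : subgroup) := {x : G | x \in sgset H}.

HB.instance Definition _ H := SubChoice.on (subgroup_type H).
HB.instance Definition _ H :=
  SubChoice_isSubGroup.Build G (fun x => x \in sgset H) (subgroup_type H) (sgP H).

End Subgroups.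

Section Quotient.
Variables (G : groupType) (N : normal_subgroup G).

Definition lcoset_rel : rel G := fun x y => x^-1 * y \in nsset N.

Let N1 : 1 \in nsset N. Proof. by have [[]] := nsP N. Qed.
Let NM : {in nsset N &, forall x y, x * y \in nsset N}.
Proof. by have [/group_closedM + _] := nsP N. Qed.
Let NV : {in nsset N, forall x, x^-1 \in nsset N}.
Proof. by have [/group_closedV + _] := nsP N. Qed.
Let NJ : {in nsset N, forall x y, x ^ y \in nsset N}.
Proof. by have [] := nsP N. Qed.

Lemma lcoset_rel_refl : reflexive lcoset_rel.
Proof. by move=> x; rewrite /lcoset_rel mulVg. Qed.
Lemma lcoset_rel_sym : symmetric lcoset_rel.
Proof.
by move=> x y; apply/idP/idP => /NV; rewrite invgM invgK.
Qed.
Lemma lcoset_rel_trans : transitive lcoset_rel.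
Proof.
by move=> y x z Nxy Nyz; have := NM Nxy Nyz; rewrite -mulgA mulVKg.
Qed.

Canonical lcoset_equiv :=
  EquivRel lcoset_rel lcoset_rel_refl lcoset_rel_sym lcoset_rel_trans.

(* The group G / N, whose elements are the cosets x N; quot_proj is the        *)
(* quotient map.                                                               *)
Definition quotient := {eq_quot lcoset_equiv}.
HB.instance Definition _ := Choice.on quotient.
HB.instance Definition _ := EqQuotient.on quotient.

Definition quot1 : quotient := \pi_quotient 1.
Definition quotM (x y : quotient) : quotient := \pi_quotient (repr x * repr y).
Definition quotV (x : quotient) : quotient := \pi_quotient (repr x)^-1.

Definition quot_proj (x : G) : quotient := \pi_quotient x.

Lemma quot_projE x y : (quot_proj x == quot_proj y) = (x^-1 * y \in nsset N).
Proof. exact: (pi_eq_quot x y). Qed.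

Lemma quot_proj_surj (a : quotient) : exists x, quot_proj x = a.
Proof. by exists (repr a); apply: reprK. Qed.

Let rep x : x^-1 * repr (quot_proj x) \in nsset N.
Proof. by rewrite -quot_projE /quot_proj reprK. Qed.

Lemma quotME x y : quotM (quot_proj x) (quot_proj y) = quot_proj (x * y).
Proof.
apply/esym/eqP; rewrite quot_projE.
have := NM (NJ (rep x) y) (rep y).
by rewrite /conjg invgM !mulgA mulgK.
Qed.

Lemma quotVE x : quotV (quot_proj x) = quot_proj x^-1.
Proof.
apply/esym/eqP; rewrite quot_projE.
have := NJ (NV (rep x)) x^-1.
by rewrite /conjg invgM !invgK !mulgA mulgK.
Qed.

Lemma quotMA : associative quotM.
Proof.
move=> a b c.
case: (quot_proj_surj a) (quot_proj_surj b) (quot_proj_surj c).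
by move=> x <- [y <-] [z <-]; rewrite !quotME mulgA.
Qed.
Lemma quot1M : left_id quot1 quotM.
Proof. by move=> a; have [x <-] := quot_proj_surj a; rewrite quotME mul1g. Qed.
Lemma quotM1 : right_id quot1 quotM.
Proof. by move=> a; have [x <-] := quot_proj_surj a; rewrite quotME mulg1. Qed.
Lemma quotVM : left_inverse quot1 quotV quotM.
Proof.
by move=> a; have [x <-] := quot_proj_surj a; rewrite quotVE quotME mulVg.
Qed.
Lemma quotMV : right_inverse quot1 quotV quotM.
Proof.
by move=> a; have [x <-] := quot_proj_surj a; rewrite quotVE quotME mulgV.
Qed.

HB.instance Definition _ :=
  isGroup.Build quotient quotMA quot1M quotM1 quotVM quotMV.

HB.instance Definition _ :=
  isMultiplicative.Build G quotient quot_proj (fun x y => esym (quotME x y)).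

End Quotient.

Section Automorphisms.
Variable G : groupType.

Record autg := Autg {
  autfun :> G -> G;
  autM : {morph autfun : x y / x * y};
  aut_bij : bijective autfun
}.

HB.instance Definition _ := gen_eqMixin autg.
HB.instance Definition _ := gen_choiceMixin autg.

HB.instance Definition _ (f : autg) := isMultiplicative.Build G G f (@autM f).

Lemma aut_id1 (f : autg) : f 1 = 1.
Proof. by apply: (mulgI (f 1)); rewrite -autM !mulg1. Qed.

HB.instance Definition _ (f : autg) :=
  Multiplicative_isUMagmaMorphism.Build G G f (aut_id1 f).

Lemma autgP (f g : autg) : f =1 g -> f = g.
Proof.
case: f g => f fM fB [g gM gB] /= /funext fg; case: g / fg in gM gB *.
by congr Autg; apply: Prop_irrelevance.
Qed.

Definition aut1 := @Autg id (fun _ _ => erefl) (Bijective (frefl id) (frefl id)).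

Lemma aut_mulM (f g : autg) : {morph f \o g : x y / x * y}.
Proof. by move=> x y /=; rewrite !autM. Qed.

(* The product of Aut(G) is composition: (f * g) x = f (g x).                  *)
Definition aut_mul (f g : autg) :=
  Autg (aut_mulM f g) (bij_comp (aut_bij f) (aut_bij g)).

Lemma aut_inv_subproof (f : autg) : {g : G -> G | cancel f g /\ cancel g f}.
Proof. by apply: cid; have [g fK gK] := aut_bij f; exists g. Qed.

Definition aut_invfun (f : autg) : G -> G := sval (aut_inv_subproof f).

Lemma aut_funK (f : autg) : cancel f (aut_invfun f).
Proof. by rewrite /aut_invfun; case: aut_inv_subproof => g []. Qed.
Lemma aut_invfunK (f : autg) : cancel (aut_invfun f) f.
Proof. by rewrite /aut_invfun; case: aut_inv_subproof => g []. Qed.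

Definition aut_inv (f : autg) :=
  Autg (can2_gmulfM (aut_funK f) (aut_invfunK f))
       (Bijective (aut_invfunK f) (aut_funK f)).

Lemma aut_mulA : associative aut_mul. Proof. by move=> f g h; apply: autgP. Qed.
Lemma aut_1mul : left_id aut1 aut_mul. Proof. by move=> f; apply: autgP. Qed.
Lemma aut_mul1 : right_id aut1 aut_mul. Proof. by move=> f; apply: autgP. Qed.
Lemma aut_mulV : left_inverse aut1 aut_inv aut_mul.
Proof. by move=> f; apply: autgP; apply: aut_funK. Qed.
Lemma aut_mulI : right_inverse aut1 aut_inv aut_mul.
Proof. by move=> f; apply: autgP; apply: aut_invfunK. Qed.

HB.instance Definition _ :=
  isGroup.Build autg aut_mulA aut_1mul aut_mul1 aut_mulV aut_mulI.

Definition inner_set : set autg := [set f | exists g, forall x, f x = x ^ g].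

Lemma inner_normal : normal_closed inner_set.
Proof.
split; first split.
- by apply/mem_set; exists 1 => x; rewrite conjg1.
- move=> f h /set_mem[a fE] /set_mem[b hE]; apply/mem_set; exists (b^-1 * a).
  move=> x; rewrite -[LHS]/(f (aut_inv h x)) fE conjgM; congr (_ ^ a).
  by apply: (can_inj (aut_funK h)); rewrite aut_invfunK hE conjgKV.
- move=> f /set_mem[a fE] h; apply/mem_set; exists (aut_inv h a) => x.
  rewrite -[LHS]/(aut_inv h (f (h x))) fE.
  apply: (can_inj (aut_funK h)); rewrite aut_invfunK gmulfJ /=.
  by rewrite aut_invfunK.
Qed.

Definition Inn := NormalSubgroup inner_normal.

Definition Out := quotient Inn.

Definition Out_proj : {multiplicative autg -> Out} := @quot_proj autg Inn.

End Automorphisms.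

(* Used only for surjective f: see quot_proj_surj.                             *)
Definition splits_virtually (A B : groupType) (f : {multiplicative A -> B}) :=
  exists (B' : subgroup B) (g : {multiplicative subgroup_type B' -> A}),
    finite_index B' /\ forall b : subgroup_type B', f (g b) = val b.

Definition isomorphic (G H : groupType) :=
  exists f : {multiplicative G -> H}, bijective f.

Definition one_relator_group (k : nat) (r : freeGroup 'I_k) :=
  quotient (ncl [set r]).

(* Being given by a presentation is understood up to isomorphism.              *)
Definition one_relator_with_torsion (G : groupType) :=
  exists (k n : nat) (R : freeGroup 'I_k),
    [/\ (1 < n)%N, R <> 1 & isomorphic G (one_relator_group (R ^+ n))].

(* Main.v *)
Require Import Defs.
From HB Require Import structures.
From mathcomp Require Import all_boot all_order all_algebra all_fingroup cyclic.
From mathcomp Require Import boolp classical_sets functions cardinality.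
From mathcomp Require Import finmap zify ring lra.

Set Implicit Arguments.
Unset Strict Implicit.
Unset Printing Implicit Defensive.

(** Write the relator R ^+ n as a conjugate of w ^+ N, where N > 1 and w is a
    cyclically reduced word that is not a proper power ([root_exists]), so that
    G = <X | w ^+ N>, and let om be the image of w in G.

    The splitting comes from the automorphisms that fix om.  Two facts on torsion
    make this work: an element of prime order is conjugate to a power of om
    ([torsion_conj]), and if x conjugates some power of om to a nontrivial power of
    om, then x is itself a power of om ([malnormal]).  Hence an automorphism sends
    om to a conjugate of one of its finitely many powers, and an inner automorphism
    that fixes om is conjugation by a power of om.  Besides, there is a finite group
    Q such that a power of om that is not central in G has a noncentral image under
    some homomorphism G -> Q ([detect]).  The automorphisms f that fix om and
    satisfy rho f = rho for all rho : G -> Q therefore form a group S that meets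
    Inn(G) trivially; its image in Out(G) has finite index because G is finitely
    generated, and the inverse of the bijection from S to its image is the section.

    The facts on torsion rest on a property of finite graphs whose edges are
    labelled by X, each letter leading from a vertex to at most one other.  In such
    a graph, consider the closed paths that read powers of w.  If they generate the
    rational homology of the graph, then some edge is crossed at most once by all
    of them together ([cycles_span_nonempty]); removing it preserves the
    hypothesis, and the graph is exhausted in this way ([collapse_ind]).  So these
    cycles are independent ([cycle_sum_prescribed]) and generate the fundamental
    group ([label_potential]).

    The existence of that edge is a counting argument of Louder and Wilton.  The
    positions of w are ordered by comparing the rotations of w in a bi-invariant
    order of the free group, so that crossing an edge preserves the order of the
    visits.  If each edge is crossed at least twice, then each cycle is topmost
    along some edge without being topmost at the vertex that it leaves along it;
    this bounds the number of cycles by #edges - #vertices, which is less than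
    the rank of the homology.

    This is applied to finite subgraphs of the coset graph of a subgroup E of the
    free group.  For torsion_conj, let u lift an element of order p: u ^+ p is a
    product of conjugates of w ^+ N or its inverse; let E be generated by u and
    these conjugates.  A rational cochain that vanishes on the cycles vanishes on
    these conjugates, hence on u ^+ p, hence on u.  So the loop u is generated by
    the cycles, and one of these must be a power of w with nontrivial image in the
    cyclic group generated by the image of u.  For malnormal, the same argument with
    E generated by w ^+ i, a conjugate of w ^+ j, and conjugates of w ^+ N shows
    that the cycles of these two powers of w coincide: otherwise an integral cochain
    that is 1 on the first cycle and 0 on all others contradicts the relation
    between them.

    The group Q comes from the Magnus expansion of w in noncommuting variables. *)

Local Open Scope group_scope.

(** * Words acting on sets *)

Section Words.
Variable X : choiceType.
Notation letter := (X * bool)%type.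

Section Act.
Variables (Om : Type) (step : Om -> letter -> Om).
Hypothesis stepK : forall v a, step (step v a) (invl a) = v.

Definition wact (v : Om) (s : seq letter) : Om := foldl step v s.

Lemma wact_cat v s t : wact v (s ++ t) = wact (wact v s) t.
Proof. exact: foldl_cat. Qed.

Lemma wact_consr v a s : wact v (consr a s) = wact (step v a) s.
Proof. by case: s => //= b s; case: eqP => // ->; rewrite stepK. Qed.

Lemma wact_catr v s t : wact v (catr s t) = wact (wact v s) t.
Proof. by elim: s v => //= a s IHs v; rewrite wact_consr IHs. Qed.

Lemma wactM v (x y : freeGroup X) : wact v (x * y) = wact (wact v x) y.
Proof. exact: wact_catr. Qed.

Lemma wact1 v : wact v (1 : freeGroup X) = v. Proof. by []. Qed.

Lemma wactK (x : freeGroup X) v : wact (wact v x) x^-1 = v.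
Proof. by rewrite -wactM mulgV wact1. Qed.

End Act.

Definition spell (s : seq letter) : freeGroup X :=
  FreeGroup (catr_reduced s (isT : reduced [::])).

Lemma spell_nil : spell [::] = 1. Proof. exact: val_inj. Qed.

Lemma spell_cons a s : spell (a :: s) = spell [:: a] * spell s.
Proof. by apply: val_inj. Qed.

Lemma spell_cat s t : spell (s ++ t) = spell s * spell t.
Proof.
elim: s => [|a s IHs]; first by apply: val_inj.
by rewrite cat_cons spell_cons IHs mulgA -spell_cons.
Qed.

Lemma spell_val (u : freeGroup X) : spell u = u.
Proof. by apply: val_inj; rewrite /= catrs0 // Defs.freeP. Qed.

Lemma val_spell s : reduced s -> val (spell s) = s.
Proof. by move=> rs /=; rewrite catrs0. Qed.

Lemma spell_inv a : spell [:: invl a] = (spell [:: a])^-1.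
Proof. by apply: val_inj. Qed.

Lemma spell_flatten n s : spell (flatten (nseq n s)) = spell s ^+ n.
Proof. by elim: n => [|n IHn]; rewrite ?spell_nil //= spell_cat IHn expgS. Qed.

Lemma wact_spell Om (step : Om -> letter -> Om) v s :
  (forall v a, step (step v a) (invl a) = v) ->
  wact step v (spell s) = wact step v s.
Proof. by move=> stepK; rewrite /spell wact_catr. Qed.

Definition letter_val (H : groupType) (phi : X -> H) (a : letter) : H :=
  if a.2 then phi a.1 else (phi a.1)^-1.

Lemma hom1 (G H : groupType) (f : {multiplicative G -> H}) : f 1 = 1.
Proof. by apply: (mulgI (f 1)); rewrite -gmulfM !mulg1. Qed.

Lemma homV (G H : groupType) (f : {multiplicative G -> H}) x : f x^-1 = (f x)^-1.
Proof. by apply: (mulgI (f x)); rewrite -gmulfM !mulgV hom1. Qed.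

Lemma homX (G H : groupType) (f : {multiplicative G -> H}) x n :
  f (x ^+ n) = f x ^+ n.
Proof. by elim: n => [|n IHn]; rewrite ?hom1 // !expgS gmulfM IHn. Qed.

Lemma homJ (G H : groupType) (f : {multiplicative G -> H}) x y :
  f (x ^ y) = f x ^ f y.
Proof. by rewrite !gmulfM homV. Qed.

Lemma hom_letter_val (H : groupType) (f : {multiplicative freeGroup X -> H}) a :
  f (spell [:: a]) = letter_val (fun x => f (spell [:: (x, true)])) a.
Proof.
by case: a => x []; rewrite /letter_val //= -[(x, false)]/(invl (x, true)) spell_inv homV.
Qed.

Lemma hom_ext (H : groupType) (f g : {multiplicative freeGroup X -> H}) :
  (forall x, f (spell [:: (x, true)]) = g (spell [:: (x, true)])) -> f =1 g.
Proof.
move=> fg u; rewrite -(spell_val u); elim: (fword u) => [|a s IHs].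
  by rewrite spell_nil !hom1.
rewrite spell_cons !gmulfM IHs !hom_letter_val; congr (_ * _).
by rewrite /letter_val; case: ifP; rewrite fg.
Qed.

End Words.

(** * Roots of words *)

(** Two words that commute are powers of a common word: the shorter one is a prefix of the
    longer one, and the rest of the longer one still commutes with it. *)
Lemma commuting_words (A : eqType) (p q : seq A) : p ++ q = q ++ p ->
  exists t a b, p = flatten (nseq a t) /\ q = flatten (nseq b t).
Proof.
have [n] := ubnP (size p + size q); elim: n p q => // n IH.
suff H (p q : seq A) : size p <= size q -> size p + size q < n.+1 -> p ++ q = q ++ p ->
    exists t a b, p = flatten (nseq a t) /\ q = flatten (nseq b t).
  move=> p q lt E; have [h|h] := leqP (size p) (size q); first exact: H.
  have [|t [a [b [pE qE]]]] := H q p (ltnW h) _ (esym E); first by rewrite addnC.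
  by exists t, b, a.
have [->|p0 le lt E] := eqVneq p [::]; first by exists q, 0%N, 1%N; rewrite /= cats0.
have qE : q = p ++ drop (size p) q.
  rewrite -{1}(cat_take_drop (size p) q); congr (_ ++ _).
  have := congr1 (take (size p)) E.
  by rewrite take_size_cat // takel_cat // => ->.
have [||t [a [b [pt qt]]]] := IH p (drop (size p) q).
- by rewrite size_drop; move: p0; rewrite -size_eq0; lia.
- have := congr1 (drop (size p)) E; rewrite drop_size_cat // => E'.
  by rewrite -qE {1}E' {1}qE -catA drop_size_cat.
exists t, a, (a + b)%N; split=> //.
by rewrite qE nseqD flatten_cat -pt -qt.
Qed.

Section Root.
Variable X : choiceType.
Notation letter := (X * bool)%type.
Implicit Types (s w : seq letter).

Lemma size_spell s : size (spell s) <= size s.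
Proof.
suff: size (catr s [::]) <= size s by [].
elim: s => //= a s; case: (catr s [::]) => //= b t.
by case: ifP => _ /=; lia.
Qed.

(** The shortest y such that R is conjugate to a power of y will do: cancelling the ends
    of y, or writing it as a power of a rotation-invariant factor, would shorten it. *)
Lemma root_exists (R : freeGroup X) : R <> 1 ->
  exists (w : seq letter) m k, [/\ 0 < size w, 0 < m, reduced (w ++ w),
    forall i, 0 < i < size w -> rot i w <> w & R = (spell w ^+ m) ^ k].
Proof.
move=> R1.
pose P d := `[< exists (y : freeGroup X) m k, R = (y ^+ m) ^ k /\ size y = d >].
have exP : exists d, P d.
  by exists (size R); apply/asboolP; exists R, 1%N, 1; rewrite expg1 conjg1.
case: (ex_minnP exP) => d /asboolP[y [m [k [RE yd]]]] dmin.
have small (z : freeGroup X) m' k' : size z < d -> R <> (z ^+ m') ^ k'.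
  move=> lt E; have /dmin : P (size z) by apply/asboolP; exists z, m', k'.
  by rewrite leqNgt lt.
have ry : reduced y := Defs.freeP y.
exists (fword y), m, k; rewrite spell_val; split=> //.
- rewrite lt0n; apply/eqP => /size0nil y0; apply: R1.
  by rewrite RE -(spell_val y) y0 spell_nil expg1n conj1g.
- by rewrite lt0n; apply: contra_notN R1 => /eqP m0; rewrite RE m0 expg0 conj1g.
- case: (fword y) yd ry (spell_val y) => // b s yd; rewrite /reduced /= cat_path /= => -> yE.
  rewrite andbT; apply/eqP; case/lastP: s yd yE => [|s c]; first by case: b => x [].
  rewrite last_rcons /= size_rcons => yd yE bc.
  apply: (@small (spell s) m (spell [:: c] * k)); first by have := size_spell s; lia.
  rewrite RE (_ : y = spell s ^ spell [:: c]) -?conjXg -?conjgM //.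
  by rewrite -yE -cats1 spell_cons spell_cat bc spell_inv.
move=> i /andP[i0 il] iE.
have [|t [a [b [pE qE]]]] := @commuting_words _ (take i y) (drop i y).
  by rewrite cat_take_drop -[RHS]/(rot i y) iE.
have szt j s : s = flatten (nseq j t) -> 0 < size s -> size t <= size s.
  by move=> ->; case: j => //= j _; rewrite size_cat leq_addr.
have := szt _ _ pE; rewrite size_takel ?(ltnW il) // => s1.
have lt : size (spell t) < d.
  apply: leq_ltn_trans (size_spell t) _; apply: leq_ltn_trans (s1 i0) _.
  by rewrite -yd.
apply: (small (spell t) ((a + b) * m)%N k lt).
by rewrite expgM expgnDr -!spell_flatten -pE -qE -spell_cat cat_take_drop spell_val.
Qed.

End Root.

Local Close Scope group_scope.

(** * The Magnus expansion and the bi-ordering of the free group *)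

Import GRing.Theory Num.Theory Order.TTheory.
Local Open Scope fset_scope.
Local Open Scope ring_scope.

Section Magnus.
Variable X : countType.
Notation letter := (X * bool)%type.

Section Step.
Variable R : comNzRingType.
Implicit Type f : seq X -> R.

(** A function f : seq X -> R is a power series in noncommuting variables; the value at m is
    the coefficient of the monomial that spells m backwards, so that multiplying by 1 + x
    on the right, or by its inverse, acts at the head of m. *)
Definition rmul x f : seq X -> R :=
  fun m => if m is y :: m' then f m + (y == x)%:R * f m' else f m.
Fixpoint rmulV x f m : R :=
  if m is y :: m' then f m - (y == x)%:R * rmulV x f m' else f m.
Definition mstep f (b : letter) : seq X -> R :=
  if b.2 then rmul b.1 f else rmulV b.1 f.
Lemma mstepK f b : mstep (mstep f b) (invl b) = f.
Proof.
case: b => x []; apply/funext; rewrite /mstep /=; elim=> // y m IH /=.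
  by rewrite IH addrK.
by rewrite subrK.
Qed.

End Step.
Arguments mstep {R} f b : simpl never.

Notation series := (seq X -> int).
Implicit Types (f g : series) (m : seq X) (x y z : X) (u v : freeGroup X).

Definition mone : series := fun m => (m == [::])%:R.
Definition magnus u : series := wact mstep mone u.

(** Left multiplication by 1 + x. *)
Definition lmul x f : series :=
  fun m => if m is y :: m' then f m + (last y m' == x)%:R * f (belast y m') else f m.

Lemma lmul_rmul x y f : lmul x (rmul y f) = rmul y (lmul x f).
Proof. by apply/funext => -[//|z [|z' m]] /=; ring. Qed.

Lemma lmul_mstep x b f : lmul x (mstep f b) = mstep (lmul x f) b.
Proof.
case: b => y []; first exact: lmul_rmul.
have rK g : rmul y (rmulV y g) = g by apply: (mstepK g (y, false)).
have rVK g : rmulV y (rmul y g) = g by apply: (mstepK g (y, true)).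
by rewrite -[LHS]rVK -lmul_rmul rK.
Qed.

Lemma wact_lmul x f s : wact mstep (lmul x f) s = lmul x (wact mstep f s).
Proof. by elim: s f => [|b s IH] f /=; rewrite -?IH ?lmul_mstep. Qed.

Lemma lmul_one x : lmul x mone = rmul x mone.
Proof. by apply/funext => -[|z [|z' m]] //=; rewrite /mone /= !mulr0. Qed.

Lemma magnus_letterl x u : magnus (spell [:: (x, true)] * u)%g = lmul x (magnus u).
Proof.
rewrite /magnus wactM; last exact: mstepK.
rewrite -[wact mstep mone (spell _)]/(rmul x mone) -lmul_one.
exact: wact_lmul.
Qed.

Lemma magnus_letterr x u : magnus (u * spell [:: (x, true)])%g = rmul x (magnus u).
Proof. by rewrite /magnus wactM //; apply: mstepK. Qed.

(** Monomials without two equal adjacent variables. *)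
Definition alt m := sorted (fun x y => x != y) m.
Arguments alt : simpl never.
Definition sg (e : bool) : int := if e then 1 else -1.

Lemma mstep_neq f x e m : ohead m != Some x -> mstep f (x, e) m = f m.
Proof.
by case: e; case: m => //= y m; rewrite (inj_eq Some_inj) /mstep /= => /negbTE->;
   rewrite mul0r ?addr0 ?subr0.
Qed.

Lemma mstep_eq f x e m : ohead m != Some x ->
  mstep f (x, e) (x :: m) = f (x :: m) + sg e * f m.
Proof.
move=> h; case: e; first by rewrite /mstep /= eqxx !mul1r.
by rewrite {1}/mstep /= -[rmulV x f m]/(mstep f (x, false) m) mstep_neq // eqxx mul1r mulN1r.
Qed.

Lemma alt_cons x m : alt (x :: m) = (ohead m != Some x) && alt m.
Proof. by case: m => //= y m; rewrite (inj_eq Some_inj) eq_sym. Qed.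

(** The expansion is faithful.  Group the letters of a reduced word into maximal blocks
    x ^ e, with e nonzero.  The monomial with one variable for each block is the longest
    alternating monomial that occurs, and its coefficient is the product of the exponents
    e.  In the induction, k is the length of the last block, and c is the product for the
    other blocks. *)
Lemma magnus_top s b : reduced (rcons s b) ->
  exists m (k : nat) (c : int), [/\ c != 0, (0 < k)%N, alt (b.1 :: m),
    wact mstep mone (rcons s b) m = c
  & wact mstep mone (rcons s b) (b.1 :: m) = sg b.2 *+ k * c] /\
   forall m', alt m' -> (size m < size m')%N ->
    (size m' = (size m).+1 -> ohead m' != Some b.1) ->
    wact mstep mone (rcons s b) m' = 0.
Proof.
elim/last_ind: s b => [|s b0 IH] b.
  case: b => x e _; rewrite /wact /=; exists [::], 1%N, 1.
  split.
    by split=> //; [rewrite mstep_neq|rewrite mstep_eq // /mone /= add0r mulr1n].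
  case=> // z m; rewrite alt_cons => /andP[zm am] _ h.
  have [E|ne] := eqVneq z x; last by rewrite mstep_neq // (inj_eq Some_inj).
  subst z; rewrite mstep_eq // /mone /= add0r.
  by case: m {zm am} h => [/(_ erefl)|? ? _]; rewrite ?eqxx // mulr0.
move=> red; have red0 : reduced (rcons s b0).
  by move: red; rewrite /reduced -cats1 => /cat_sorted2[].
have [m [k [c [[c0 k0 am fm fxm] van]]]] := IH _ red0.
have ne : b != invl b0.
  by move: red; rewrite -cats1 cat_rcons /reduced => /cat_sorted2[_] /= /andP[].
rewrite -[rcons (rcons s b0) b]cats1 wact_cat /=.
move: (wact mstep mone (rcons s b0)) fm fxm van => f fm fxm van.
case: b0 b ne am fm fxm van {IH red red0} => x e [y e'] /= ne am fm fxm van.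
move: (am); rewrite alt_cons => /andP[hm am'].
have [E|nyx] := eqVneq y x.
  have {}E' : e' = e.
    by move: ne; rewrite E /invl /= -pair_eqE /pair_eq /= eqxx /=; case: (e); case: (e').
  subst y e'; exists m, k.+1, c; split.
    split=> //; first by rewrite mstep_neq.
    by rewrite mstep_eq // fm fxm mulrSr mulrDl.
  case=> // z m1 am1 sz h; have := am1; rewrite alt_cons => /andP[zm1 am1'].
  have [E|nzx] := eqVneq z x; last first.
    by rewrite mstep_neq ?(inj_eq Some_inj) // van // => _ /=; rewrite (inj_eq Some_inj).
  subst z; have lt : (size m < size m1)%N.
    by move: sz; rewrite /= ltnS leq_eqVlt => /orP[/eqP E|//]; case/eqP: (h (congr1 succn (esym E))).
  rewrite mstep_eq // van ?van ?mulr0 ?addr0 //.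
exists (x :: m), 1%N, (sg e *+ k * c); split.
  split=> //.
  - by rewrite mulf_neq0 // mulrn_eq0 negb_or -lt0n k0; case: (e).
  - by rewrite alt_cons am andbT /= (inj_eq Some_inj) eq_sym.
  - by rewrite mstep_neq ?fxm //= (inj_eq Some_inj) eq_sym.
  rewrite mstep_eq /= ?(inj_eq Some_inj) 1?eq_sym // fxm mulr1n van ?add0r //.
    by rewrite alt_cons am andbT /= (inj_eq Some_inj) eq_sym.
case=> // z m1 am1 sz h; have := am1; rewrite alt_cons => /andP[zm1 am1'].
have sz1 : (size m < size m1)%N by move: sz => /=; rewrite ltnS.
have f0 : f (z :: m1) = 0.
  by rewrite van //= ?ltnS ?(ltnW sz1) // => -[E]; rewrite E ltnn in sz1.
have [E|nzx] := eqVneq z y; last by rewrite mstep_neq ?(inj_eq Some_inj).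
subst z; rewrite mstep_eq // f0 add0r van ?mulr0 // => E.
by move: (h (congr1 succn E)); rewrite eqxx.
Qed.

Lemma magnus_neq1 u : u <> 1%g -> magnus u <> mone.
Proof.
move=> u1; have := Defs.freeP u; have : spell u <> 1%g by rewrite spell_val.
rewrite /magnus; case: (lastP (fword u)) => [|s b _ red E].
  by rewrite spell_nil => /(_ erefl).
have [m [k [c [[c0 k0 _ _ +] _]]]] := magnus_top red.
rewrite E /mone /= => /esym/eqP; rewrite mulf_eq0 (negbTE c0) orbF mulrn_eq0.
by rewrite gtn_eqF //; case: (b.2).
Qed.

Definition mlt m' m :=
  (size m' < size m)%N || (size m' == size m) && (choice.pickle m' < choice.pickle m)%N.

Definition pos f := exists2 m, 0 < f m & forall m', mlt m' m -> f m' = 0.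

(** Equivalently, f and g have the same homogeneous part of lowest degree. *)
Definition lead f g := forall m, (forall m', (size m' < size m)%N -> f m' = 0) -> g m = f m.

Lemma lead_sym f g : lead f g -> lead g f.
Proof.
move=> fg m g0; rewrite fg // => m'; have [n] := ubnP (size m').
elim: n m' => // n IH m' lt lt'; rewrite -fg ?g0 // => m2 lt2.
by apply: IH; [apply: leq_trans lt2 _|apply: ltn_trans lt2 _].
Qed.

Lemma lead_pos f g : lead f g -> pos f -> pos g.
Proof.
move=> fg [m fm m0]; exists m => [|m' lt].
  by rewrite fg // => m' lt; rewrite m0 // /mlt lt.
rewrite fg ?m0 // => m2 lt2; rewrite m0 // /mlt.
move: lt; rewrite /mlt => /orP[lt|/andP[/eqP <- _]]; last by rewrite lt2.
by rewrite (ltn_trans lt2 lt).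
Qed.

Lemma lead_rmul x f : lead f (rmul x f).
Proof. by case=> // y m f0; rewrite /= (f0 m) // mulr0 addr0. Qed.

Lemma lead_lmul x f : lead f (lmul x f).
Proof.
by case=> // y m f0; rewrite /= (f0 (belast y m)) ?mulr0 ?addr0 //= size_belast.
Qed.

Lemma mlt_total m m' : m <> m' -> mlt m m' \/ mlt m' m.
Proof.
move=> ne; rewrite /mlt; case: (ltngtP (size m) (size m')) => _ /=; [by left|by right|].
case: (ltngtP (choice.pickle m) (choice.pickle m')) => [_|_|/(pcan_inj (@choice.pickleK _))//]; [by left|by right].
Qed.

Lemma mlt_trans m2 m1 m3 : mlt m1 m2 -> mlt m2 m3 -> mlt m1 m3.
Proof. rewrite /mlt; lia. Qed.

Lemma posD f g : pos f -> pos g -> pos (fun m => f m + g m).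
Proof.
move=> [m fm f0] [m' gm g0]; have [E|/mlt_total[] lt] := pselect (m = m').
- by subst m'; exists m => [|m' lt]; rewrite ?addr_gt0 // f0 // g0.
- exists m => [|m2 lt2]; first by rewrite (g0 m) // addr0.
  by rewrite f0 // g0 // (mlt_trans lt2 lt).
exists m' => [|m2 lt2]; first by rewrite (f0 m') // add0r.
by rewrite g0 // f0 // (mlt_trans lt2 lt).
Qed.

Lemma first_nonzero f : f <> (fun=> 0) ->
  exists2 m, f m != 0 & forall m', mlt m' m -> f m' = 0.
Proof.
move=> fn0; have [m0 fm0] : exists m, f m != 0.
  by apply: contrapT => H; apply: fn0; apply/funext => m; apply/eqP/negP => h; apply: H; exists m; apply/negP.
pose P n := `[< exists m, f m != 0 /\ size m = n >].
have exP : exists n, P n by exists (size m0); apply/asboolP; exists m0.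
case: (ex_minnP exP) => d /asboolP[m1 [fm1 sm1]] dmin.
pose Q n := `[< exists m, [/\ f m != 0, size m = d & choice.pickle m = n] >].
have exQ : exists n, Q n by exists (choice.pickle m1); apply/asboolP; exists m1.
case: (ex_minnP exQ) => q /asboolP[m [fm sm pm]] qmin.
exists m => // m' lt; apply/eqP/negPn/negP => h.
have /dmin dle : P (size m') by apply/asboolP; exists m'.
move: lt; rewrite /mlt sm ltnNge dle /= => /andP[/eqP E]; rewrite ltnNge pm qmin //.
by apply/asboolP; exists m'.
Qed.

(** Multiplying by 1 + x on either side preserves the homogeneous part of lowest degree,
    so this total order is invariant under translations, hence under conjugation. *)
Definition flt u v : Prop := pos (fun m => magnus v m - magnus u m).

Lemma flt_irr u : ~ flt u u.
Proof. by case=> m; rewrite subrr ltxx. Qed.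

Lemma flt_trans u v t : flt u v -> flt v t -> flt u t.
Proof.
move=> uv vt; have := posD uv vt; rewrite /flt; congr pos.
by apply/funext => m; ring.
Qed.

Lemma magnus_inj : injective magnus.
Proof.
move=> u v E; apply: contrapT => ne.
apply: (@magnus_neq1 (u * v^-1)%g).
  by move=> E1; apply: ne; rewrite -[u](mulgKV v) E1 mul1g.
by rewrite /magnus (wactM (@mstepK _)) -/(magnus u) E (wactK (@mstepK _)).
Qed.

Lemma flt_total u v : u <> v -> flt u v \/ flt v u.
Proof.
move=> ne; have [|m fm f0] := @first_nonzero (fun m => magnus v m - magnus u m).
  move=> E; apply: ne; apply: magnus_inj; apply/funext => m; apply/esym/eqP.
  by rewrite -subr_eq0; have /(congr1 (@^~ m)) /= -> := E.
move: fm; case: ltgtP => // fm _; first by right; exists m => [|m' /f0 E];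
  rewrite -opprB ?oppr_gt0 // E oppr0.
by left; exists m.
Qed.

Lemma flt_conj b u v u' v' :
  (spell [:: b] * u')%g = (u * spell [:: b])%g -> (spell [:: b] * v')%g = (v * spell [:: b])%g ->
  flt u v <-> flt u' v'.
Proof.
wlog bt : b u v u' v' / b.2 => [H|].
  case hb: b.2; first exact: H.
  move=> Eu Ev; apply: iff_sym; apply: (H (invl b)); rewrite ?spell_inv.
  - by rewrite /= hb.
  - by apply: (mulgI (spell [:: b])); rewrite mulVKg mulgA Eu mulgK.
  by apply: (mulgI (spell [:: b])); rewrite mulVKg mulgA Ev mulgK.
case: b bt => x [] // _ Eu Ev.
have E : lmul x (fun m => magnus v' m - magnus u' m)
       = rmul x (fun m => magnus v m - magnus u m).
  have /(congr1 magnus) := Eu; have /(congr1 magnus) := Ev.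
  rewrite !magnus_letterl !magnus_letterr => E1 E2; apply/funext => m.
  have := congr1 (@^~ m) E1; have := congr1 (@^~ m) E2.
  by case: m => [|y m] /=; lra.
split=> [/(lead_pos (@lead_rmul x _))|/(lead_pos (@lead_lmul x _))].
  by rewrite -E; apply: lead_pos; apply: lead_sym; apply: lead_lmul.
by rewrite E; apply: lead_pos; apply: lead_sym; apply: lead_rmul.
Qed.

(** The positions of w, ordered by the corresponding rotations.  Moving to the next position
    conjugates the rotation by a letter, so positions with equal or opposite letters are
    moved monotonically.  The rotations are distinct because w is not a proper power. *)
Section Stacking.
Variable w : seq letter.
Notation l := (size w).
Hypothesis w_red : reduced (w ++ w).
Hypothesis w_prim : forall i, (0 < i < l)%N -> rot i w <> w.

Definition wletter (i : 'I_l) : letter := tnth (in_tuple w) i.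

Lemma wletter_nth b (i : 'I_l) : wletter i = nth b w i.
Proof. exact: (tnth_nth b (in_tuple w)). Qed.

Lemma wletter_red (i : 'I_l) : wletter (ordS i) <> invl (wletter i).
Proof.
move: w_red; rewrite /reduced.
have b := wletter i => /(sortedP b)/(_ i) H; apply/eqP; move: H.
rewrite size_cat !nth_cat ltn_ord -!wletter_nth.
have -> : (if (i.+1 < l)%N then nth b w i.+1 else nth b w (i.+1 - l)) = wletter (ordS i).
  rewrite (wletter_nth b) /=; case: ltnP => h; first by rewrite modn_small.
  have -> : i.+1 = l by apply/eqP; rewrite eqn_leq h ltn_ord.
  by rewrite modnn subnn.
by apply; move: (ltn_ord i); lia.
Qed.

Definition wrot (i : 'I_l) : freeGroup X := spell (rot i w).

Lemma rot_reduced i : reduced (rot i w).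
Proof.
have [h|h] := leqP l i; first by rewrite rot_oversize //; case/cat_sorted2: w_red.
have E : w ++ w = take i w ++ rot i w ++ drop i w.
  by rewrite /rot -catA cat_take_drop catA cat_take_drop.
by move: w_red; rewrite E /reduced => /cat_sorted2[_] /cat_sorted2[].
Qed.

Lemma wrot_inj : injective wrot.
Proof.
move=> i j /(congr1 val); rewrite !val_spell; try exact: rot_reduced.
wlog lt : i j / (i < j)%N => [H|] E.
  case: (ltngtP i j) => [h|h|/val_inj//]; first exact: H.
  by apply/esym; apply: H.
case: (@w_prim (j - i)%N); first by move: (ltn_ord j); lia.
have le : (i <= j)%N by apply: ltnW.
by apply: (@rot_inj i); rewrite -rotD ?subnKC // ltnW.
Qed.

Lemma wrot_conj (i : 'I_l) : (spell [:: wletter i] * wrot (ordS i))%g = (wrot i * spell [:: wletter i])%g.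
Proof.
rewrite -!spell_cat; congr spell; rewrite cats1 /=.
have -> : rot (i.+1 %% l) w = drop i.+1 w ++ take i.+1 w.
  have [h|h] := ltnP i.+1 l; first by rewrite modn_small.
  have -> : i.+1 = l by apply/eqP; rewrite eqn_leq h ltn_ord.
  by rewrite modnn rot0 drop_size take_size.
rewrite -cat_cons (take_nth (wletter i)) // -(wletter_nth (wletter i)).
rewrite {1}(wletter_nth (wletter i)) -drop_nth //.
by rewrite rcons_cat.
Qed.

Definition wrank (i : 'I_l) : nat := #|[set j : 'I_l | `[< flt (wrot j) (wrot i) >]]|.

Lemma wrank_lt i j : (wrank i < wrank j)%N <-> flt (wrot i) (wrot j).
Proof.
have mono i' j' : flt (wrot i') (wrot j') -> (wrank i' < wrank j')%N.
  move=> h; apply: proper_card; apply/properP; split.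
    by apply/fintype.subsetP => k; rewrite !inE => /asboolP hk; apply/asboolP/(flt_trans hk).
  by exists i'; rewrite !inE; [apply/asboolP|apply/asboolPn/flt_irr].
split=> [lt|/mono//].
have [E|/flt_total[//|/mono]] := pselect (wrot i = wrot j).
  by rewrite (wrot_inj E) ltnn in lt.
by rewrite ltnNge (ltnW lt).
Qed.

Lemma wrank_inj : injective wrank.
Proof.
move=> i j E; apply: wrot_inj; apply: contrapT => /flt_total[] /wrank_lt;
  by rewrite E ltnn.
Qed.

Lemma wrank_same i j : wletter i = wletter j -> (wrank i < wrank j)%N = (wrank (ordS i) < wrank (ordS j))%N.
Proof.
move=> E; have Ej := wrot_conj j; rewrite -E in Ej.
have [h1 h2] := flt_conj (wrot_conj i) Ej.
by apply/idP/idP => /wrank_lt h; apply/wrank_lt; auto.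
Qed.

Lemma wrank_opp i j : wletter j = invl (wletter i) -> (wrank i < wrank (ordS j))%N = (wrank (ordS i) < wrank j)%N.
Proof.
move=> E; have Ej : (spell [:: wletter i] * wrot j)%g = (wrot (ordS j) * spell [:: wletter i])%g.
  apply: (mulgI (spell [:: wletter j])); rewrite mulgA E spell_inv mulVg mul1g.
  by rewrite mulgA -spell_inv -E wrot_conj E spell_inv -mulgA mulVg mulg1.
have [h1 h2] := flt_conj (wrot_conj i) Ej.
by apply/idP/idP => /wrank_lt h; apply/wrank_lt; auto.
Qed.

End Stacking.
End Magnus.
Arguments mstep {X R} f b : simpl never.

(** * Cycles in labelled graphs *)

Lemma singular_system (T : finType) (F : fieldType) (M : T -> T -> F) (y : T -> F) :
  (exists t, y t != 0) -> (forall t', \sum_t y t * M t t' = 0) ->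
  exists2 c : T -> F, exists t, c t != 0 & forall t, \sum_t' M t t' * c t' = 0.
Proof.
move=> [t0 yt0] yM.
pose A := \matrix_(i < #|T|, j < #|T|) M (enum_val i) (enum_val j).
have dA : \det A == 0.
  apply/det0P; exists (\row_i y (enum_val i)).
    apply: contra_neq yt0 => /rowP/(_ (enum_rank t0)).
    by rewrite !mxE enum_rankK.
  apply/rowP => j; rewrite !mxE -[RHS](yM (enum_val j)).
  rewrite [RHS](reindex (@enum_val T T)) /=; last exact/onW_bij/enum_val_bij.
  by apply: eq_bigr => i _; rewrite !mxE.
move: dA; rewrite -det_tr => /det0P[v v0 vA].
exists (fun t => v ord0 (enum_rank t)).
  have /rV0Pn[i vi] := v0.
  by exists (enum_val i); rewrite enum_valK.
move=> t; rewrite (reindex (@enum_val T T)) /=; last exact/onW_bij/enum_val_bij.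
have /rowP/(_ (enum_rank t)) := vA; rewrite !mxE => vt; rewrite -[RHS]vt.
by apply: eq_bigr => i _; rewrite !mxE enum_rankK enum_valK mulrC.
Qed.

Definition least (P : pred nat) : nat :=
  match pselect (exists K, P K) with left h => ex_minn h | right _ => 0%N end.

(** A pair (v, i) is a visit of the vertex v at the position i of the cyclic word a; the next
    visit is obtained by following the letter a i.  The edge (v, x) goes from v to the vertex
    reached by the letter (x, true).  A finite set D of edges is a finite graph, and its cycles
    are the orbits of visits that stay in D.  The ranks rk provide an order of the visits of
    a vertex that is preserved along edges. *)
Section Graph.
Variables (X Om : choiceType) (l : nat).
Notation letter := (X * bool)%type.
Variable step : Om -> letter -> Om.
Hypothesis stepK : forall v b, step (step v b) (invl b) = v.
Variables (a : 'I_l -> letter) (rk : 'I_l -> nat).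
Hypothesis rk_inj : injective rk.
Hypothesis a_red : forall i, a (ordS i) <> invl (a i).
Hypothesis rk_same : forall i j, a i = a j ->
  (rk i < rk j)%N = (rk (ordS i) < rk (ordS j))%N.
Hypothesis rk_opp : forall i j, a j = invl (a i) ->
  (rk i < rk (ordS j))%N = (rk (ordS i) < rk j)%N.

Let stepVK v b : step (step v (invl b)) b = v.
Proof. by rewrite -{2}(invlK b) stepK. Qed.

Definition nxt (p : Om * 'I_l) : Om * 'I_l := (step p.1 (a p.2), ordS p.2).
Definition prv (p : Om * 'I_l) : Om * 'I_l :=
  (step p.1 (invl (a (ord_pred p.2))), ord_pred p.2).

Lemma nextK : cancel nxt prv.
Proof. by case=> v i; rewrite /prv /nxt /= ordSK stepK. Qed.
Lemma prevK : cancel prv nxt.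
Proof. by case=> v i; rewrite /prv /nxt /= ord_predK stepVK. Qed.
Definition next_inj := can_inj nextK.

Definition tgt (e : Om * X) := step e.1 (e.2, true).
Definition letter_edge v (b : letter) : Om * X := if b.2 then (v, b.1) else (step v b, b.1).
Definition pair_edge p := letter_edge p.1 (a p.2).

Lemma pair_edge_fwd p : (a p.2).2 ->
  (pair_edge p).1 = p.1 /\ tgt (pair_edge p) = (nxt p).1.
Proof. by rewrite /pair_edge /letter_edge /tgt /nxt /=; case: (a p.2) => x []. Qed.

Lemma pair_edge_bwd p : ~~ (a p.2).2 ->
  (pair_edge p).1 = (nxt p).1 /\ tgt (pair_edge p) = p.1.
Proof.
by rewrite /pair_edge /letter_edge /tgt /nxt /=; case: (a p.2) => x [] //= _.
Qed.

Section Cyc.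
Variable D : {fset Om * X}.

Definition cycle_in p : bool := `[< forall j, pair_edge (iter j nxt p) \in D >].

Lemma cycle_in_edge p : cycle_in p -> pair_edge p \in D.
Proof. by move=> /asboolP/(_ 0%N). Qed.

Lemma cycle_in_iter p j : cycle_in p -> cycle_in (iter j nxt p).
Proof. by move=> /asboolP Pp; apply/asboolP => i; rewrite -iterD. Qed.

Lemma pair_edge_inj p q : pair_edge p = pair_edge q -> p.2 = q.2 -> p = q.
Proof.
case: p q => [v i] [v' j] /= E ij; move: E; rewrite -{}ij {j} => E.
congr (_, _); case h: (a i).2.
  by have [/= <- _] := @pair_edge_fwd (v, i) h; have [/= <- _] := @pair_edge_fwd (v', i) h; rewrite E.
move/negbT in h.
by have [_ /= <-] := @pair_edge_bwd (v, i) h; have [_ /= <-] := @pair_edge_bwd (v', i) h; rewrite E.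
Qed.

(** The edge and the position determine the visit, so a forward orbit in D is finite. *)
Lemma cycle_in_periodic p : cycle_in p -> exists K, (0 < K)%N && (iter K nxt p == p).
Proof.
move=> /asboolP Pp; pose N := (#|{: D}| * l)%N.
pose h (j : 'I_N.+1) := ([` Pp j], (iter j nxt p).2) : (D * 'I_l)%type.
have hN : ~~ injectiveb h.
  apply/negP => /injectiveP /leq_card.
  by rewrite card_prod !card_ord ltnn.
move: hN => /injectivePn[i [j ij [E1 E2]]].
have E : iter i nxt p = iter j nxt p by apply: pair_edge_inj.
wlog ltij : i j ij {E1 E2} E / (i < j)%N.
  move=> H; case: (ltngtP i j) => [|ji|/val_inj E']; first exact: H.
    by apply: (H j i) => //; rewrite eq_sym.
  by rewrite E' eqxx in ij.
exists (j - i)%N; rewrite subn_gt0 ltij; apply/eqP.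
have : iter i nxt (iter (j - i) nxt p) = iter i nxt p.
  by rewrite -iterD subnKC // ltnW.
by move: (iter (j - i) nxt p) => q; elim: (nat_of_ord i) => //= m IH E1; apply: IH; apply: next_inj.
Qed.

End Cyc.

Definition period p : nat := least (fun K => (0 < K)%N && (iter K nxt p == p)).

Lemma periodP D p : cycle_in D p -> (0 < period p)%N /\ iter (period p) nxt p = p.
Proof.
move=> /cycle_in_periodic h; rewrite /period /least; case: pselect => // h'.
by case: ex_minnP => m /andP[m0 /eqP].
Qed.

Lemma period_min K p : (0 < K)%N -> iter K nxt p = p -> (0 < period p <= K)%N.
Proof.
move=> K0 Kp; rewrite /period /least; case: pselect => [h|[]]; last first.
  by exists K; rewrite K0 Kp eqxx.
by case: ex_minnP => m /andP[-> _] -> //; rewrite K0 Kp eqxx.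
Qed.

Lemma period_next p : period (nxt p) = period p.
Proof.
have E : (fun K => (0 < K)%N && (iter K nxt (nxt p) == nxt p))
       = (fun K => (0 < K)%N && (iter K nxt p == p)).
  by apply/funext => K; rewrite -iterSr /= (inj_eq next_inj).
by rewrite /period E.
Qed.

Lemma period_dvd K p : iter K nxt p = p -> (0 < K)%N -> (period p %| K)%N.
Proof.
move=> Kp K0; have /andP[P0 _] := period_min K0 Kp.
have Pp : iter (period p) nxt p = p.
  by rewrite /period /least; case: pselect => // h; case: ex_minnP => m /andP[_ /eqP].
have mp m : iter (m * period p) nxt p = p.
  by elim: m => // m IH; rewrite mulSn iterD IH.
rewrite /dvdn; apply/negPn/negP; rewrite -lt0n => r0.
have: iter (K %% period p)%N nxt p = p.
  by move: Kp; rewrite {1}(divn_eq K (period p)) addnC iterD mp.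
by move=> /(period_min r0)/andP[_]; rewrite leqNgt ltn_mod P0.
Qed.

Section Cochain.
Variable Z : zmodType.
Implicit Types (c : Om * X -> Z).

Definition letter_coch c v (b : letter) : Z := if b.2 then c (letter_edge v b) else - c (letter_edge v b).
Definition pair_coch c p := letter_coch c p.1 (a p.2).
Definition cycle_sum c p := \sum_(j < period p) pair_coch c (iter j nxt p).

Lemma sum_iter_next (F : Om * 'I_l -> Z) K p : iter K nxt p = p ->
  \sum_(j < K) F (iter j nxt (nxt p)) = \sum_(j < K) F (iter j nxt p).
Proof.
move=> Kp; under eq_bigr do rewrite -iterSr.
case: K Kp => [|K] Kp; first by rewrite !big_ord0.
by rewrite big_ord_recr [RHS]big_ord_recl Kp addrC.
Qed.

Lemma cycle_sum_next D c p : cycle_in D p -> cycle_sum c (nxt p) = cycle_sum c p.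
Proof. by move=> /periodP[_ Kp]; rewrite /cycle_sum period_next sum_iter_next. Qed.

Lemma cycle_sum_iter D c p j : cycle_in D p -> cycle_sum c (iter j nxt p) = cycle_sum c p.
Proof.
by move=> Dp; elim: j => //= j IH; rewrite (@cycle_sum_next D) ?cycle_in_iter.
Qed.

Lemma sum_period c K p : iter K nxt p = p ->
  \sum_(j < K) pair_coch c (iter j nxt p) = cycle_sum c p *+ (K %/ period p).
Proof.
case: K => [|K] Kp; first by rewrite div0n big_ord0.
have /dvdnP[m E] := period_dvd Kp isT.
have /andP[P0 _] := period_min (isT : 0 < K.+1)%N Kp.
have Pp : iter (period p) nxt p = p.
  by rewrite /period /least; case: pselect => // h; case: ex_minnP => ? /andP[_ /eqP].
rewrite E mulnK //; elim: m {E} => [|m IH]; first by rewrite mul0n big_ord0.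
rewrite mulSn big_split_ord /= -/(cycle_sum c p) mulrS; congr (_ + _)%R.
by rewrite -IH; apply: eq_bigr => j _; rewrite addnC iterD Pp.
Qed.

Lemma eq_cycle_sum c c' p : (forall j, c (pair_edge (iter j nxt p)) = c' (pair_edge (iter j nxt p))) ->
  cycle_sum c p = cycle_sum c' p.
Proof.
by move=> E; apply: eq_bigr => j _; rewrite /pair_coch /letter_coch -[letter_edge _ _]/(pair_edge (iter j nxt p)) E.
Qed.

(** Adjusting the value on an edge that the cycle crosses once gives any cycle sum. *)
Lemma cycle_sum_solve D c (k : Z) p0 : cycle_in D p0 ->
  (forall p, cycle_in D p -> pair_edge p = pair_edge p0 -> p = p0) ->
  exists2 c', forall e, e != pair_edge p0 -> c' e = c e & cycle_sum c' p0 = k.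
Proof.
move=> D0 U; have [P0 Pp] := periodP D0.
pose S := \sum_(j < (period p0).-1) pair_coch c (iter j.+1 nxt p0).
pose z := if (a p0.2).2 then k - S else S - k.
exists (fun e => if e == pair_edge p0 then z else c e); first by move=> e /negbTE->.
have ne j : (j < (period p0).-1)%N -> pair_edge (iter j.+1 nxt p0) != pair_edge p0.
  move=> jP; apply/eqP => /(U _ (cycle_in_iter j.+1 D0)) /(period_min (isT : 0 < j.+1)%N).
  by lia.
rewrite /cycle_sum -(prednK P0) big_ord_recl [X in _ + X](_ : _ = S).
  rewrite /pair_coch /letter_coch /= -[letter_edge _ _]/(pair_edge p0) eqxx /z.
  by case: ((a p0.2).2); rewrite ?opprB subrK.
apply: eq_bigr => j _; rewrite /pair_coch /letter_coch lift0.
by rewrite -[letter_edge _ _]/(pair_edge (iter j.+1 nxt p0)) (negbTE (ne _ (ltn_ord j))).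
Qed.

End Cochain.

(** The cycles generate the rational homology of D, in dual form. *)
Definition cycles_span (D : {fset Om * X}) := forall c : Om * X -> rat,
  (forall p, cycle_in D p -> cycle_sum c p = 0) ->
  exists f : Om -> rat, forall e, e \in D -> f (tgt e) - f e.1 = c e.

Definition unvisited D e := forall p, cycle_in D p -> pair_edge p <> e.
Definition once D p0 := cycle_in D p0 /\ forall p, cycle_in D p -> pair_edge p = pair_edge p0 -> p = p0.

Lemma cycle_in_sub D D' p : D `<=` D' -> cycle_in D p -> cycle_in D' p.
Proof. by move=> /fsubsetP DD /asboolP Pp; apply/asboolP => j; apply/DD. Qed.

Lemma cycle_in_del D e p : cycle_in D p -> (forall j, pair_edge (iter j nxt p) <> e) ->
  cycle_in (D `\ e) p.
Proof.
move=> /asboolP Pp ne; apply/asboolP => j.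
by rewrite !inE Pp andbT; apply/eqP.
Qed.

(** Removing an edge that no cycle crosses: extend a cochain by 0. *)
Lemma cycles_span_unvisited D e : e \in D -> cycles_span D -> unvisited D e -> cycles_span (D `\ e).
Proof.
move=> De VD U c c0; pose c' e' := if e' == e then 0 else c e'.
have [p Dp|f fE] := VD c'.
  have ne j : pair_edge (iter j nxt p) <> e by apply/U/cycle_in_iter.
  rewrite -(c0 p (cycle_in_del Dp ne)); apply: eq_cycle_sum => j.
  by rewrite /c'; case: eqP => // /ne.
exists f => e'; rewrite !inE => /andP[/negbTE ne De']; rewrite fE // /c' ne //.
Qed.

(** Removing an edge that is crossed once: its value is determined by the cycle sum. *)
Lemma cycles_span_once D p0 : cycles_span D -> once D p0 -> cycles_span (D `\ pair_edge p0).
Proof.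
move=> VD [D0 U] c c0.
have [c' c'E c'0] := cycle_sum_solve c 0 D0 U.
have [p Dp|f fE] := VD c'.
  have [[j E]|ne] := pselect (exists j, pair_edge (iter j nxt p) = pair_edge p0).
    by rewrite -(cycle_sum_iter c' j Dp) (U _ _ E) // cycle_in_iter.
  have {}ne j : pair_edge (iter j nxt p) <> pair_edge p0 by move=> E; apply: ne; exists j.
  rewrite -(c0 p (cycle_in_del Dp ne)); apply: eq_cycle_sum => j.
  by rewrite c'E //; apply/eqP.
by exists f => e'; rewrite !inE => /andP[ne De']; rewrite fE // c'E.
Qed.

(** The positions at which a visit of an edge stands at the source and at the target of the
    edge. *)
Definition src_pos (p : Om * 'I_l) := if (a p.2).2 then p.2 else ordS p.2.
Definition tgt_pos (p : Om * 'I_l) := if (a p.2).2 then ordS p.2 else p.2.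

Lemma cycle_in_next D p : cycle_in D p -> cycle_in D (nxt p).
Proof. exact: (@cycle_in_iter D p 1). Qed.

Lemma cycle_in_prev D p : cycle_in D p -> cycle_in D (prv p) /\ exists j, prv p = iter j nxt p.
Proof.
move=> Dp; have [P0 Pp] := periodP Dp.
suff E : prv p = iter (period p).-1 nxt p by rewrite E cycle_in_iter //; split=> //; eexists.
by apply: next_inj; rewrite prevK -iterS prednK.
Qed.

Lemma cycle_in_src_pos D p : cycle_in D p -> cycle_in D ((pair_edge p).1, src_pos p).
Proof.
rewrite /src_pos => Dp; case: ifPn => h.
  by have [-> _] := pair_edge_fwd h; case: p Dp {h}.
by have [-> _] := pair_edge_bwd h; apply: cycle_in_next.
Qed.

Lemma cycle_in_tgt_pos D p : cycle_in D p -> cycle_in D (tgt (pair_edge p), tgt_pos p).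
Proof.
rewrite /tgt_pos => Dp; case: ifPn => h.
  by have [_ ->] := pair_edge_fwd h; apply: cycle_in_next.
by have [_ ->] := pair_edge_bwd h; case: p Dp {h}.
Qed.

Lemma pair_edge_opp p q : pair_edge p = pair_edge q -> (a p.2).2 -> ~~ (a q.2).2 ->
  a q.2 = invl (a p.2).
Proof.
rewrite /pair_edge /letter_edge; case: (a p.2) => x []; case: (a q.2) => y [] //=.
by move=> [_ ->].
Qed.

Lemma pair_edge_same p q : pair_edge p = pair_edge q -> (a p.2).2 = (a q.2).2 ->
  a p.2 = a q.2.
Proof.
by rewrite /pair_edge /letter_edge; case: (a p.2) => x []; case: (a q.2) => y [] //= [_ ->].
Qed.

(** So the visits of an edge are ordered consistently at its two ends. *)
Lemma rk_src_tgt p q : pair_edge p = pair_edge q ->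
  (rk (src_pos p) < rk (src_pos q))%N = (rk (tgt_pos p) < rk (tgt_pos q))%N.
Proof.
move=> E; rewrite /src_pos /tgt_pos.
case hp: (a p.2).2; case hq: (a q.2).2.
- by apply: rk_same; apply: pair_edge_same; rewrite // hp hq.
- by apply: rk_opp; apply: pair_edge_opp; rewrite // ?hp ?hq.
- by apply/esym/rk_opp; rewrite (pair_edge_opp (esym E)) ?invlK ?hp ?hq.
- by apply/esym/rk_same; apply: pair_edge_same; rewrite // hp hq.
Qed.

(** Opposite crossings of an edge cannot be at the same position of the source, because a is
    cyclically reduced. *)
Lemma src_pos_inj p q : pair_edge p = pair_edge q -> src_pos p = src_pos q -> p = q.
Proof.
move=> E; rewrite /src_pos; case hp: (a p.2).2; case hq: (a q.2).2 => Ei.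
- exact: pair_edge_inj.
- case: (@a_red q.2); rewrite -Ei (@pair_edge_opp p q) ?invlK ?hp ?hq //.
- by case: (@a_red p.2); rewrite Ei (@pair_edge_opp q p) ?invlK ?hp ?hq.
- by apply: pair_edge_inj => //; apply: ordS_inj.
Qed.

Lemma tgt_pos_inj p q : pair_edge p = pair_edge q -> tgt_pos p = tgt_pos q -> p = q.
Proof.
move=> E Et; apply: src_pos_inj => //; apply: rk_inj.
case: (ltngtP (rk (src_pos p)) (rk (src_pos q))) => // h; move: h.
  by rewrite rk_src_tgt // Et ltnn.
by rewrite rk_src_tgt // Et ltnn.
Qed.

Lemma iter_pos j p : val (iter j nxt p).2 = ((p.2 + j) %% l)%N.
Proof.
elim: j => [|j IH]; first by rewrite addn0 modn_small.
by rewrite iterS /= IH -addn1 modnDml addn1 addnS.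
Qed.

Lemma hit_pos p i : exists j, (iter j nxt p).2 = i.
Proof.
exists (i + l - p.2)%N; apply: val_inj; rewrite iter_pos.
by rewrite subnKC ?modnDr ?modn_small // ltnW // ltn_addl.
Qed.

Lemma max_pair (S : Om * 'I_l -> Prop) (h : Om * 'I_l -> 'I_l) :
  (exists p, S p) -> exists p, S p /\ forall q, S q -> (rk (h q) <= rk (h p))%N.
Proof.
move=> [p0 S0]; pose P m := `[< exists p, S p /\ rk (h p) = m >].
have [|m|m /asboolP[p [Sp <-]] max] := @ex_maxnP P (\max_i rk i)%N.
- by exists (rk (h p0)); apply/asboolP; exists p0.
- by move=> /asboolP[p [_ <-]]; apply: leq_bigmax.
- by exists p; split=> // q Sq; apply: max; apply/asboolP; exists q.
Qed.

Section Core.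
Variable D : {fset Om * X}.
Hypothesis twice : forall e, e \in D ->
  exists p q, [/\ cycle_in D p, cycle_in D q, pair_edge p = e, pair_edge q = e & p <> q].

Definition top_vertex p := cycle_in D p /\ forall q, cycle_in D q -> q.1 = p.1 -> (rk q.2 <= rk p.2)%N.

Definition top_visit p :=
  cycle_in D p /\ forall q, cycle_in D q -> pair_edge q = pair_edge p -> (rk (src_pos q) <= rk (src_pos p))%N.

Lemma top_visit_inj p q : top_visit p -> top_visit q -> pair_edge p = pair_edge q -> p = q.
Proof.
move=> [Dp mp] [Dq mq] E; apply: src_pos_inj => //; apply: rk_inj.
by apply/eqP; rewrite eqn_leq mq // mp.
Qed.

(** A crossing that is topmost at an end of its edge is topmost along the edge. *)
Lemma top_end_visit q : cycle_in D q ->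
  top_vertex ((pair_edge q).1, src_pos q) \/ top_vertex (tgt (pair_edge q), tgt_pos q) -> top_visit q.
Proof.
move=> Dq H; split=> // p Dp E; case: H => [] [_ m].
  by apply: (m ((pair_edge p).1, src_pos p)); rewrite ?cycle_in_src_pos // E.
rewrite leqNgt rk_src_tgt // -leqNgt.
by apply: (m (tgt (pair_edge p), tgt_pos p)); rewrite ?cycle_in_tgt_pos // E.
Qed.

Lemma top_vertex_TV p : top_vertex p -> top_visit p.
Proof.
move=> Tp; have [Dp _] := Tp; apply: top_end_visit => //; rewrite /src_pos /tgt_pos; case: ifPn => h.
  by left; have [-> _] := pair_edge_fwd h; case: p Tp {Dp h}.
by right; have [_ ->] := pair_edge_bwd h; case: p Tp {Dp h}.
Qed.

Lemma top_vertex_prev_TV p : top_vertex p -> top_visit (prv p).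
Proof.
move=> Tp; have [Dp _] := Tp; have [Dq _] := cycle_in_prev Dp.
apply: top_end_visit => //; rewrite /src_pos /tgt_pos; case: ifPn => h.
  right; have [_ ->] := pair_edge_fwd h; move: Tp; rewrite -{1}(prevK p).
  by case: (prv p).
left; have [-> _] := pair_edge_bwd h; move: Tp; rewrite -{1}(prevK p).
by case: (prv p).
Qed.

(** Otherwise the topmost vertex visits of the cycle would be stable under going backwards.
    There is one, at the highest position of a, so all the visits would be topmost; but the
    lowest position of a is not topmost along its edge, which is crossed twice. *)
Lemma TV_not_top p : cycle_in D p -> exists j, top_visit (iter j nxt p) /\ ~ top_vertex (iter j nxt p).
Proof.
move=> Dp; apply: contrapT => none.
have allTV j : top_visit (iter j nxt p) -> top_vertex (iter j nxt p).
  by move=> tv; apply: contrapT => nt; apply: none; exists j.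
have [imax maxP] : exists i, forall j, (rk j <= rk i)%N.
  have [q [_ mq]] := @max_pair (fun _ => True) snd (ex_intro _ p I).
  by exists q.2 => j; apply: (mq (p.1, j)).
have [imin minP] : exists i, forall j, (rk i <= rk j)%N.
  by exists [arg min_(i < p.2) rk i]%N => j; case: arg_minnP => // i _; apply.
have [j1 j1E] := hit_pos p imin; set q := iter j1 nxt p in j1E.
have Dq : cycle_in D q by apply: cycle_in_iter.
have [j2 j2E] := hit_pos q imax.
have topq : top_vertex (iter j2 nxt q).
  by split=> [|r Dr _]; rewrite ?cycle_in_iter // j2E.
have down j : top_vertex (iter j nxt q) -> top_vertex q.
  elim: j => // j IH /top_vertex_prev_TV; rewrite iterS nextK => tv; apply: IH.
  by move: tv; rewrite /q -iterD; apply: allTV.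
have [_ tvq] := top_vertex_TV (down _ topq).
have [q1 [q2 [Dq1 Dq2 E1 E2 ne]]] := twice (cycle_in_edge Dq).
have low r : cycle_in D r -> pair_edge r = pair_edge q -> r = q.
  move=> Dr E; have := tvq _ Dr E; case h: (a q.2).2 => le.
    apply: src_pos_inj => //; apply: rk_inj; apply/eqP; rewrite eqn_leq le.
    by rewrite {1}/src_pos h j1E minP.
  apply: tgt_pos_inj => //; apply: rk_inj; apply/eqP.
  have tq : tgt_pos q = imin by rewrite /tgt_pos h.
  by rewrite eqn_leq {2}tq minP andbT leqNgt -rk_src_tgt // -leqNgt.
by apply: ne; rewrite (low _ Dq1 E1) (low _ Dq2 E2).
Qed.

Lemma top_at v : (exists2 p, cycle_in D p & p.1 = v) -> exists2 p, top_vertex p & p.1 = v.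
Proof.
move=> [p Dp pv].
have [|q [[Dq qv] m]] := @max_pair (fun q => cycle_in D q /\ q.1 = v) snd.
  by exists p.
by exists q => //; split=> // r Dr E; apply: m; rewrite E.
Qed.

Lemma topvisit_exists (e : D) : exists p, top_visit p /\ pair_edge p = val e.
Proof.
have [p [_ [Dp _ E _ _]]] := twice (valP e).
have [|q [[Dq Eq] m]] := @max_pair (fun q => cycle_in D q /\ pair_edge q = val e) src_pos.
  by exists p.
by exists q; split=> //; split=> // r Dr Er; apply: m; rewrite Er.
Qed.

(** Each edge e has a topmost crossing tv e.  Consider the linear system with one equation for
    each e: that c has no divergence at the vertex of tv e, if tv e is topmost at that vertex,
    and that c vanishes on the cycle of tv e, otherwise.  The divergences add up to 0, so this
    square system has a nonzero solution c.  Every vertex and every cycle is concerned by some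
    equation ([TV_not_top]), so that c is a cochain that vanishes on the cycles and is
    orthogonal to coboundaries: it is not a coboundary. *)
Lemma cycles_span_nonempty e0 : e0 \in D -> ~ cycles_span D.
Proof.
move=> De0 VD; have [tv tvP] := choice topvisit_exists.
have tvE p (Dp : cycle_in D p) : top_visit p -> tv [` cycle_in_edge Dp] = p.
  by move=> Tp; have [T E] := tvP [` cycle_in_edge Dp]; apply: top_visit_inj.
pose top e := `[< top_vertex (tv e) >].
have one v : (exists2 p, cycle_in D p & p.1 = v) ->
    \sum_(e : D | top e) (v == (tv e).1)%:R = 1 :> rat.
  move=> /top_at[p Tp pv]; have Dp := Tp.1.
  have E := tvE p Dp (top_vertex_TV Tp).
  rewrite (bigD1 [` cycle_in_edge Dp]) /= ?E ?pv ?eqxx; last by rewrite /top E; apply/asboolP.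
  rewrite big1 ?addr0 // => e /andP[/asboolP Te ne].
  case: eqP => // ve; case/eqP: ne; apply: val_inj => /=.
  have [_ <-] := tvP e; congr pair_edge; case: (tv e) Te ve => v' i [Di mi] /= ve.
  case: p Tp pv {E Dp} => v'' j [Dj mj] /= vE; subst v'' v'.
  congr pair; apply: rk_inj; apply/eqP; rewrite eqn_leq.
  by rewrite (mj (v, i)) // (mi (v, j)).
have srcV (e : D) : exists2 p, cycle_in D p & p.1 = (val e).1.
  by have [[Dp _] E] := tvP e; exists ((pair_edge (tv e)).1, src_pos (tv e)); rewrite ?cycle_in_src_pos ?E.
have tgtV (e : D) : exists2 p, cycle_in D p & p.1 = tgt (val e).
  by have [[Dp _] E] := tvP e; exists (tgt (pair_edge (tv e)), tgt_pos (tv e)); rewrite ?cycle_in_tgt_pos ?E.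
pose dv v (e : D) : rat := (tgt (val e) == v)%:R - ((val e).1 == v)%:R.
pose M (e e' : D) : rat := if top e then dv (tv e).1 e'
  else cycle_sum (fun x => (x == val e')%:R) (tv e).
have sum_dv (F : Om -> rat) (e' : D) :
    \sum_(e | top e) F (tv e).1 * dv (tv e).1 e' = F (tgt (val e')) - F (val e').1.
  have FE v : (exists2 p, cycle_in D p & p.1 = v) ->
      F v = \sum_(e | top e) F (tv e).1 * (v == (tv e).1)%:R.
    move=> /one v1; rewrite -[LHS]mulr1 -{1}v1 mulr_sumr; apply: eq_bigr => e _.
    by case: eqP => [->//|_]; rewrite !mulr0.
  rewrite (FE _ (tgtV e')) (FE _ (srcV e')) -sumrB.
  by apply: eq_bigr => e _; rewrite mulrBr.
have [||c [t ct] cM] := @singular_system D rat M (fun e => (top e)%:R).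
- have [p Tp _] := top_at (srcV [` De0]).
  exists [` cycle_in_edge Tp.1]; rewrite /top (tvE _ _ (top_vertex_TV Tp)).
  by rewrite (asboolT Tp).
- move=> e'; rewrite -[RHS](subrr 1) -[RHS](sum_dv (fun=> 1) e').
  rewrite [RHS]big_mkcond; apply: eq_bigr => e _.
  by rewrite /M; case: ifP => _; rewrite ?mul1r ?mul0r.
pose c' x : rat := \sum_(e : D) (x == val e)%:R * c e.
have c'E (e : D) : c' (val e) = c e.
  rewrite /c' (bigD1 e) //= eqxx mul1r big1 ?addr0 // => e' /negbTE ne.
  by rewrite (inj_eq val_inj) eq_sym ne mul0r.
have c'cycle_sum p : cycle_sum c' p = \sum_e cycle_sum (fun x => (x == val e)%:R) p * c e.
  under eq_bigr do rewrite mulr_suml.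
  rewrite exchange_big /=; apply: eq_bigr => j _; rewrite /pair_coch /letter_coch.
  by case: ifP => _; rewrite /c' // -sumrN; apply: eq_bigr => e _; rewrite mulNr.
have [p Dp|f fE] := VD c'.
  have [j [Tj nTj]] := TV_not_top Dp.
  rewrite -(cycle_sum_iter c' j Dp) c'cycle_sum; have Dj := Tj.1.
  have := cM [` cycle_in_edge Dj]; rewrite /M /top (tvE _ _ Tj).
  by rewrite (asboolF nTj).
have : \sum_(e : D) c e ^+ 2 = 0.
  transitivity (\sum_(e : D) c e * \sum_(e1 | top e1) f (tv e1).1 * dv (tv e1).1 e).
    by apply: eq_bigr => e _; rewrite sum_dv fE ?fsvalP // c'E expr2.
  under eq_bigr do rewrite mulr_sumr.
  rewrite exchange_big big1 //= => e1 Te1.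
  rewrite -[RHS](mulr0 (f (tv e1).1)) -[in RHS](cM e1) mulr_sumr.
  by apply: eq_bigr => e _; rewrite /M Te1; ring.
move/eqP; rewrite psumr_eq0 => [/allP/(_ t)|e _]; last exact: sqr_ge0.
by rewrite mem_index_enum sqrf_eq0 (negbTE ct) => /(_ isT).
Qed.

End Core.

(** A graph whose cycles generate its homology collapses to nothing. *)
Lemma collapse_ind (P : {fset Om * X} -> Prop) :
  P fset0 ->
  (forall D e, e \in D -> cycles_span D -> unvisited D e -> P (D `\ e) -> P D) ->
  (forall D p0, once D p0 -> P (D `\ pair_edge p0) -> P D) ->
  forall D, cycles_span D -> P D.
Proof.
move=> P0 Pun Pone D; have [n] := ubnP #|` D|.
elim: n D => // n IH D ltDn VD.
have [->//|/fset0Pn[e0 De0]] := eqVneq D fset0.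
have lt e : e \in D -> (#|` D `\ e| < n)%N.
  by move=> De; move: ltDn; rewrite (cardfsD1 e) De.
have [[e De U]|nU] := pselect (exists2 e, e \in D & unvisited D e).
  by apply: (Pun D e) => //; apply: IH; rewrite ?lt //; apply: cycles_span_unvisited.
have [[p0 O]|nO] := pselect (exists p0, once D p0).
  have De := cycle_in_edge O.1.
  by apply: (Pone D p0) => //; apply: IH; rewrite ?lt //; apply: cycles_span_once.
exfalso; apply: (@cycles_span_nonempty D _ e0 De0 VD) => e De.
have /existsNP[p /not_implyP[Dp /contrapT Ep]] : ~ unvisited D e by move=> U; apply: nU; exists e.
have /existsNP[q /not_implyP[Dq /not_implyP[Eq ne]]] :
    ~ (forall q, cycle_in D q -> pair_edge q = pair_edge p -> q = p).
  by move=> U; apply: nO; exists p.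
by exists p, q; split; rewrite ?Eq //; apply: nesym.
Qed.

(** The cycles are linearly independent: in a collapse, each cycle has an edge of its own. *)
Lemma cycle_sum_prescribed (Z : zmodType) D : cycles_span D -> forall k : Om * 'I_l -> Z,
  (forall p, cycle_in D p -> k (nxt p) = k p) ->
  exists c : Om * X -> Z, forall p, cycle_in D p -> cycle_sum c p = k p.
Proof.
move: D; apply: collapse_ind => [|D e De _ U IH|D p0 [D0 U] IH] k kN.
- by exists (fun=> 0) => p /cycle_in_edge.
- have [c cE] := IH k (fun p Dp => kN p (cycle_in_sub (fsubD1set _ _) Dp)).
  exists c => p Dp; apply: cE; apply: cycle_in_del => // j.
  by apply/U/cycle_in_iter.
have [c cE] := IH k (fun p Dp => kN p (cycle_in_sub (fsubD1set _ _) Dp)).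
have [c' c'E c'0] := cycle_sum_solve c (k p0) D0 U.
have kI j p : cycle_in D p -> k (iter j nxt p) = k p.
  by move=> Dp; elim: j => //= j IHj; rewrite kN ?cycle_in_iter.
exists c' => p Dp.
have [[j E]|ne] := pselect (exists j, pair_edge (iter j nxt p) = pair_edge p0).
  by rewrite -(cycle_sum_iter c' j Dp) -(kI j) // (U _ _ E) // cycle_in_iter.
have {}ne j : pair_edge (iter j nxt p) <> pair_edge p0 by move=> E; apply: ne; exists j.
rewrite -(cE p (cycle_in_del Dp ne)); apply: eq_cycle_sum => j.
by rewrite c'E //; apply/eqP.
Qed.

Section Label.
Variables (H : groupType) (phi : X -> H).
Local Open Scope group_scope.

Definition label p K := \prod_(j < K) letter_val phi (a (iter j nxt p).2).

Lemma label_next p : iter (period p) nxt p = p -> (0 < period p)%N ->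
  label (nxt p) (period p) = label p (period p) ^ letter_val phi (a p.2).
Proof.
rewrite /label; case: (period p) => // K Kp _.
rewrite big_ord_recr [in RHS]big_ord_recl /= -iterSr Kp /conjg !mulgA mulVg mul1g.
by congr (_ * _); apply: eq_bigr => j _; rewrite -iterSr.
Qed.

Lemma label_iter D p j : cycle_in D p ->
  label (iter j nxt p) (period p) = 1 -> label p (period p) = 1.
Proof.
move=> Dp; elim: j => // j IH /= E; apply: IH.
have Dj := cycle_in_iter j Dp; have [P0 Pp] := periodP Dj.
have perE : period (iter j nxt p) = period p by elim: j {E Dj P0 Pp} => //= j <-; rewrite period_next.
move: E; rewrite -perE label_next // => E.
by apply: (@conjg_inj _ (letter_val phi (a (iter j nxt p).2))); rewrite E conj1g.
Qed.

(** The cycles normally generate the fundamental groupoid: labels that multiply to 1 along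
    the cycles derive from a potential.  When an edge e that no cycle crosses is put back, the
    rational potential g of the indicator of e shows that e joins two components, on one of
    which f may be translated. *)
Lemma label_potential D : cycles_span D -> (forall p, cycle_in D p -> label p (period p) = 1) ->
  exists f : Om -> H, forall e, e \in D -> f (tgt e) = f e.1 * phi e.2.
Proof.
move: D; apply: collapse_ind => [|D e De VD U IH|D p0 [D0 U] IH] lab1.
- by exists (fun=> 1).
- have [f fE] := IH (fun p Dp => lab1 p (cycle_in_sub (fsubD1set _ _) Dp)).
  have [p Dp|g gE] := VD (fun x => (x == e)%:R%R).
    rewrite -[RHS](_ : cycle_sum (fun=> 0%R) p = 0%R).
      apply: eq_cycle_sum => j; case: eqP => // E.
      by case: (U _ (cycle_in_iter j Dp) E).
    by apply: big1 => j _; rewrite /pair_coch /letter_coch; case: ifP; rewrite ?oppr0.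
  have ge := gE e De; rewrite eqxx in ge.
  pose h := f e.1 * phi e.2 * (f (tgt e))^-1.
  exists (fun v => if g v == g (tgt e) then h * f v else f v) => e' De'.
  have [->|ne] := eqVneq e' e.
    rewrite eqxx ifN; first by rewrite /h mulgKV.
    by apply/eqP => E; move: ge; rewrite E subrr => /esym/eqP; rewrite oner_eq0.
  have := gE e' De'; rewrite (negbTE ne) => /eqP; rewrite subr_eq0 => /eqP ->.
  by rewrite fE ?inE ?ne //; case: ifP => _; rewrite ?mulgA.
have [f fE] := IH (fun p Dp => lab1 p (cycle_in_sub (fsubD1set _ _) Dp)).
have step1 q : pair_edge q \in D `\ pair_edge p0 -> f (nxt q).1 = f q.1 * letter_val phi (a q.2).
  move=> /fE; rewrite /pair_edge /letter_edge /tgt /letter_val /nxt /=; case: (a q.2) => x [] //= E.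
  apply: (mulIg (phi x)); rewrite mulgKV -E; congr f.
  by rewrite (stepK _ (x, false)).
have steps K q : (forall j, (j < K)%N -> pair_edge (iter j nxt q) \in D `\ pair_edge p0) ->
    f (iter K nxt q).1 = f q.1 * label q K.
  elim: K => [|K IHK] qD; first by rewrite /label big_ord0 mulg1.
  rewrite iterS step1 ?qD // IHK => [|j ltj]; last by rewrite qD // ltnW.
  by rewrite /label big_ord_recr /= mulgA.
have [P0 Pp] := periodP D0.
have ne j : (j < (period p0).-1)%N -> pair_edge (iter j.+1 nxt p0) != pair_edge p0.
  move=> jP; apply/eqP => /(U _ (cycle_in_iter j.+1 D0)) /(period_min (isT : 0 < j.+1)%N).
  by lia.
have around : f p0.1 = f (nxt p0).1 * label (nxt p0) (period p0).-1.
  rewrite -steps -?iterSr ?prednK ?Pp // => j jP.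
  by rewrite -iterSr !inE ne //; apply: cycle_in_edge; apply: cycle_in_iter.
have loop : letter_val phi (a p0.2) * label (nxt p0) (period p0).-1 = 1.
  rewrite -(lab1 _ D0) -[in RHS](prednK P0) /label big_ord_recl; congr (_ * _).
  by apply: eq_bigr => j _; rewrite -iterSr lift0.
have last : f (nxt p0).1 = f p0.1 * letter_val phi (a p0.2).
  by rewrite around -mulgA -(mulg1_eq loop) mulVg mulg1.
exists f => e De; have [->|ne'] := eqVneq e (pair_edge p0); last by rewrite fE // !inE ne'.
move: last; rewrite /pair_edge /letter_edge /tgt /letter_val /nxt /=; case: (a p0.2) => x [] //= E.
by rewrite E mulgKV (stepK _ (x, false)).
Qed.

End Label.

End Graph.

(** * Integration of cochains along words *)
Section Integral.
Variables (X Om : choiceType) (step : Om -> X * bool -> Om) (Z : zmodType).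
Hypothesis stepK : forall v b, step (step v b) (invl b) = v.
Variable c : Om * X -> Z.

(** Integration is the action of words on a covering with group Z, hence compatible with
    cancellation. *)
Definition istep (vq : Om * Z) b := (step vq.1 b, vq.2 + letter_coch step c vq.1 b).

Lemma istepK vq b : istep (istep vq b) (invl b) = vq.
Proof.
case: vq => v q; rewrite /istep /= stepK; congr (_, _).
rewrite -addrA -[RHS]addr0; congr (_ + _); case: b => x []; rewrite /letter_coch /letter_edge /=.
  by rewrite (stepK v (x, true)) subrr.
by rewrite addNr.
Qed.

Definition wsum v (s : seq (X * bool)) : Z := (wact istep (v, 0) s).2.

Lemma wact_istep v q s : wact istep (v, q) s = (wact step v s, q + wsum v s).
Proof.
rewrite /wsum; elim: s v q => [|b s IH] v q /=; first by rewrite addr0.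
by rewrite IH [in RHS]IH /= add0r addrA.
Qed.

Lemma wsum_cons v b s : wsum v (b :: s) = letter_coch step c v b + wsum (step v b) s.
Proof. by rewrite {1}/wsum /= wact_istep /= add0r. Qed.

Lemma wsum_cat v s t : wsum v (s ++ t) = wsum v s + wsum (wact step v s) t.
Proof. by rewrite {1}/wsum wact_cat wact_istep wact_istep /= add0r. Qed.

Lemma wsum_spell v s : wsum v (spell s) = wsum v s.
Proof. by rewrite /wsum wact_spell //; apply: istepK. Qed.

Lemma wsumM v (x y : freeGroup X) :
  wsum v (x * y)%g = wsum v x + wsum (wact step v x) y.
Proof. by rewrite -{1}(spell_val x) -{1}(spell_val y) -spell_cat wsum_spell wsum_cat. Qed.

End Integral.

(** * Finite quotients in which powers of u survive *)

Section FiniteRep.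
Variable X : countType.
Notation F := (freeGroup X).
Notation letter := (X * bool)%type.

Section Perm.
Variables (T : finType) (step : T -> letter -> T).
Hypothesis stepK : forall t b, step (step t b) (invl b) = t.

Lemma wact_inj (u : F) : injective (fun t => wact step t u).
Proof. by move=> t t' /(congr1 (fun t => wact step t u^-1%g)); rewrite !wactK. Qed.

Definition perm_rep (u : F) : {perm T} := perm (@wact_inj u).

Lemma perm_repE u t : perm_rep u t = wact step t u.
Proof. by rewrite permE. Qed.

Lemma perm_repM : {morph perm_rep : u v / (u * v)%g}.
Proof. by move=> u v; apply/permP => t; rewrite permM !perm_repE wactM. Qed.

HB.instance Definition _ := isMultiplicative.Build F {perm T} perm_rep perm_repM.

End Perm.

Section Convolution.
Variable R : comNzRingType.
Implicit Types (f g : seq X -> R) (h : seq X -> int).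

Lemma mstep_tail f g m b : (forall j, (0 < j)%N -> f (drop j m) = g (drop j m)) ->
  mstep f b m - f m = mstep g b m - g m.
Proof.
case: b => x [] fg; rewrite /mstep /=.
  case: m fg => [|y m] fg; first by rewrite /= !subrr.
  by have := fg 1%N isT; rewrite /= drop0 => ->; rewrite !(addrAC _ _ (- _)) !subrr.
suff E m' : (forall j, f (drop j m') = g (drop j m')) -> rmulV x f m' = rmulV x g m'.
  case: m fg => [|y m] fg; first by rewrite /= !subrr.
  rewrite /= E => [|j]; last by rewrite (fg j.+1).
  by rewrite !(addrAC _ _ (- _ (y :: m))) !subrr.
elim: m' => [|y m' IH] fg' /=; first exact: (fg' 0%N).
by rewrite IH => [|j]; rewrite ?(fg' j.+1) // (fg' 0%N).
Qed.

Lemma mstep_local f g m b : (forall j, f (drop j m) = g (drop j m)) ->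
  mstep f b m = mstep g b m.
Proof.
move=> fg; apply: (addIr (- f m)); rewrite (@mstep_tail f g) => [|j _//].
by have := fg 0%N; rewrite drop0 => ->.
Qed.

(** The product of the series h and f, for monomials spelled backwards. *)
Definition conv h f : seq X -> R :=
  fun m => \sum_(i < (size m).+1) (h (take i m))%:~R * f (drop i m).

Lemma conv_one f : conv (@mone X) f = f.
Proof.
apply/funext => m; rewrite /conv big_ord_recl take0 drop0 mul1r big1 ?addr0 // => i _.
case: m i => [[//]|y m] i; rewrite lift0 /= /mone /= mulr0z mul0r //.
Qed.

Lemma conv_rmul x h f : conv (rmul x h) f = rmul x (conv h f).
Proof.
apply/funext => -[|y m].
  by rewrite /conv /= !big_ord1.
rewrite /= /conv big_ord_recl [in RHS]big_ord_recl /= -addrA; congr (_ + _).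
rewrite mulr_sumr -big_split; apply: eq_bigr => i _ /=.
by rewrite intrD rmorphM /= rmorph_nat mulrDl mulrA.
Qed.

Lemma conv_mstep b h f : conv (mstep h b) f = mstep (conv h f) b.
Proof.
case: b => x []; first exact: conv_rmul.
have rK (R' : comNzRingType) (g : seq X -> R') : rmul x (rmulV x g) = g.
  exact: (mstepK g (x, false)).
have rVK g : rmulV x (rmul x g) = g by apply: (mstepK g (x, true)).
by rewrite -[LHS]rVK -conv_rmul rK.
Qed.

Lemma wact_conv f s : wact mstep f s = conv (wact mstep (@mone X) s) f.
Proof.
elim/last_ind: s => [|s b IH]; first by rewrite conv_one.
by rewrite -cats1 !wact_cat /= IH conv_mstep.
Qed.

End Convolution.

Lemma magnus_nil (u : F) : magnus u [::] = 1.
Proof.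
rewrite /magnus; elim/last_ind: (fword u) => // s [x e] IH.
by rewrite -cats1 wact_cat -[RHS]IH /=; case: e; rewrite /mstep.
Qed.

Lemma magnus_lowest (u : F) : u <> 1%g -> exists m, [/\ (0 < size m)%N, magnus u m != 0
  & forall m', (0 < size m' < size m)%N -> magnus u m' = 0].
Proof.
move=> u1; have [|m fm f0] := @first_nonzero _ (fun m => magnus u m - @mone X m).
  move=> E; apply: (magnus_neq1 u1); apply/funext => m; apply/eqP.
  by rewrite -subr_eq0; have /(congr1 (@^~ m)) /= -> := E.
case: m fm f0 => [|y m]; first by rewrite magnus_nil subrr eqxx.
rewrite {1}/mone /= subr0 => fm f0; exists (y :: m); split=> // m' /andP[m'0 lt].
have := f0 m'; rewrite /mlt lt => /(_ isT) /eqP.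
by case: m' m'0 {lt} => // z m' _; rewrite {1}/mone /= subr0 => /eqP.
Qed.

(** Multiplication by 1 + x on the right involves only the coefficients at m and at its suffixes,
    so it acts on the finite set of functions on the suffixes of m0. *)
Section Suffix.
Variables (R : finComNzRingType) (m0 : seq X).
Notation d := (size m0).
Notation T := {ffun 'I_d.+1 -> R}.

Definition sext (t : T) : seq X -> R := fun m =>
  if m == drop (d - size m) m0 then t (inord (d - size m)) else 0.
Definition sres (f : seq X -> R) : T := [ffun j : 'I_d.+1 => f (drop j m0)].

Lemma sextE t j : (j <= d)%N -> sext t (drop j m0) = t (inord j).
Proof. by move=> jd; rewrite /sext size_drop subKn // eqxx. Qed.

Lemma sresK : cancel sext sres.
Proof.
by move=> t; apply/ffunP => j; rewrite ffunE sextE -1?ltnS // inord_val.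
Qed.

Lemma sext_res f j : sext (sres f) (drop j m0) = f (drop j m0).
Proof.
have [jd|jd] := leqP j d; first by rewrite sextE // ffunE inordK.
by rewrite drop_oversize ?(ltnW jd) // -(drop_size m0) sextE // ffunE inordK.
Qed.

Definition sstep (t : T) b : T := sres (mstep (sext t) b).

Lemma sres_local f g b : sres f = sres g -> sres (mstep f b) = sres (mstep g b).
Proof.
move=> E; apply/ffunP => j; rewrite !ffunE; apply: mstep_local => i.
by rewrite drop_drop -(sext_res f) -(sext_res g) E.
Qed.

Lemma sstep_res f b : sstep (sres f) b = sres (mstep f b).
Proof. by apply: sres_local; rewrite sresK. Qed.

Lemma sstepK t b : sstep (sstep t b) (invl b) = t.
Proof. by rewrite {2}/sstep sstep_res mstepK sresK. Qed.

Lemma wact_sstep t s : wact sstep t s = sres (wact mstep (sext t) s).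
Proof.
rewrite -{1}(sresK t); elim: s (sext t) => //= b s IH f.
by rewrite sstep_res IH.
Qed.

End Suffix.

(** Let m0 be a shortest nonconstant monomial of the expansion of u, with coefficient a.  On
    functions on the suffixes of m0, multiplication by u only adds a times the constant
    coefficient to the coefficient of m0.  This commutes with the letters, and has order n
    modulo n * `|a|. *)
Lemma central_rep (u : F) n : u <> 1%g -> (1 < n)%N ->
  exists (T : finType) (step : T -> letter -> T),
  [/\ forall t b, step (step t b) (invl b) = t,
      forall t, wact step t (u ^+ n)%g = t,
      forall t b, wact step (step t b) u = step (wact step t u) b
    & forall i, (0 < i < n)%N -> exists t, wact step t (u ^+ i)%g <> t].
Proof.
move=> u1 n1; have [m0 [d0 a0 low]] := magnus_lowest u1.
pose M := (n * absz (magnus u m0))%N; set a := magnus u m0 in a0 M.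
have M1 : (1 < M)%N by rewrite /M; move: a0; rewrite -absz_gt0; nia.
pose R := 'Z_M; pose step := @sstep R m0.
pose tau (t : {ffun 'I_(size m0).+1 -> R}) k : {ffun 'I_(size m0).+1 -> R} :=
  [ffun j => t j + (j == ord0)%:R * (k%:~R * t ord_max)].
have top0 : (ord_max == ord0 :> 'I_(size m0).+1) = false.
  by apply/eqP => /(congr1 val) /= E; rewrite E in d0.
have wu t : wact step t u = tau t a.
  rewrite wact_sstep wact_conv -/(magnus u); apply/ffunP => j; rewrite !ffunE /conv.
  rewrite big_ord_recl take0 drop0 magnus_nil mul1r sextE -1?ltnS // inord_val; congr (_ + _).
  have [->|j0] := eqVneq j ord0.
    rewrite drop0 mul1r; have last : ((size m0).-1 < size m0)%N by rewrite prednK.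
    rewrite (bigD1 (Ordinal last)) // big1 ?addr0 => [|i ne].
      rewrite lift0 /= prednK // take_size drop_size -[in sext _ _](drop_size m0) sextE //.
      by rewrite addr0; congr (_ * t _); apply: val_inj; rewrite /= inordK.
    have : i != (size m0).-1 :> nat by apply: contraNneq ne => E; apply/eqP/val_inj.
    by move=> ne'; rewrite low ?mul0r // lift0 size_takel; move: (ltn_ord i); lia.
  rewrite mul0r big1 // => i _; rewrite low ?mul0r //.
  have jd := ltn_ord j; have id := ltn_ord i; have sz := size_drop j m0.
  have j1 : (0 < j)%N by rewrite lt0n; apply: contraNneq j0 => E; apply/eqP/val_inj.
  by rewrite lift0 size_takel //; lia.
have tau_max t k : tau t k ord_max = t ord_max by rewrite ffunE top0 mul0r addr0.
have tauD t k k' : tau (tau t k) k' = tau t (k + k').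
  apply/ffunP => j; rewrite [LHS]ffunE tau_max !ffunE intrD; ring.
have stepK t b : step (step t b) (invl b) = t by apply: sstepK.
have wuX t i : wact step t (u ^+ i)%g = tau t (a *+ i).
  elim: i t => [|i IH] t.
    by rewrite expg0 wact1 mulr0n; apply/ffunP => j; rewrite ffunE mulr0z mul0r mulr0 addr0.
  by rewrite expgS wactM // wu IH tauD mulrS.
have Mz z : (z%:~R == 0 :> R) = (M%:Z %| z)%Z.
  have Mk k : (k%:R == 0 :> R) = (M %| k)%N by rewrite -val_eqE /= val_Zp_nat.
  case: z => k; first by rewrite -pmulrn Mk dvdzE.
  by rewrite NegzE mulrNz oppr_eq0 -pmulrn Mk dvdzE abszN.
exists {ffun 'I_(size m0).+1 -> R}, step; split=> //.
- move=> t; rewrite wuX; apply/ffunP => j; rewrite ffunE.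
  have /eqP -> : (a *+ n)%:~R == 0 :> R.
    by rewrite Mz dvdzE /M -mulr_natr abszM natz absz_nat mulnC.
  by rewrite mul0r mulr0 addr0.
- move=> t b; rewrite !wu; apply/ffunP => j.
  have := @mstep_tail R (sext (tau t a)) (sext t) (drop j m0) b.
  have mnil (f : seq X -> R) : mstep f b [::] = f [::] by case: b => x [].
  rewrite /step /sstep !ffunE -[drop ord_max m0]/(drop (size m0) m0) drop_size mnil.
  rewrite !sextE -1?ltnS // !inord_val => H.
  have tmx (t' : {ffun 'I_(size m0).+1 -> R}) : sext t' [::] = t' ord_max.
    rewrite -(drop_size m0) sextE //; congr (t' _).
    by apply: val_inj; rewrite /= inordK.
  have tmax := tmx t; have tmax' := tmx (tau t a).
  have low_eq i' : (0 < i')%N ->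
      sext (tau t a) (drop i' (drop j m0)) = sext t (drop i' (drop j m0)).
    move=> i0; rewrite drop_drop; have [h|h] := leqP (i' + j) (size m0).
      have -> : sext (tau t a) (drop (i' + j) m0) = tau t a (inord (i' + j)) by apply: sextE.
      rewrite sextE // ffunE (_ : inord (i' + j) == ord0 = false) ?mul0r ?addr0 //.
      by apply/eqP => /(congr1 val) /=; rewrite inordK //; lia.
    by rewrite drop_oversize ?(ltnW h) // tmax tmax' tau_max.
  rewrite tmax; have /(canRL (subrK _)) -> := H low_eq.
  by rewrite ffunE; ring.
move=> i /andP[i0 ilt]; exists [ffun _ => 1]; rewrite wuX => /ffunP/(_ ord0).
rewrite !ffunE mulr1 eqxx mul1r => /(canRL (addKr _)); rewrite addNr => /eqP.
rewrite Mz dvdzE /M -mulr_natr abszM natz absz_nat mulnC.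
rewrite dvdn_pmul2l ?absz_gt0 // => /dvdn_leq; lia.
Qed.

End FiniteRep.

(** Let u act centrally on T0 with order n, let zeta be the action of u ^+ i, and extend the
    action to the product of T0 with Z = 'Z_n.+1 by letting letters add cochains of the form
    v x = y x \o zeta - y x.  Since zeta commutes with the letters, u ^+ n still acts trivially.
    Let psi v be the integral of v along u ^+ i.  If u ^+ i commutes with the letters, then v is
    determined by psi v, which has the same form as each v x, because n is invertible in Z.
    So #|V| ^ #|X| families v inject into the set V of functions of this form. *)
Lemma noncentral_rep (X : finType) (u : freeGroup X) n :
  u <> 1%g -> (1 < n)%N -> (1 < #|X|)%N ->
  exists T : finType, forall i, (0 < i < n)%N ->
    exists rho : {multiplicative freeGroup X -> {perm T}}, rho (u ^+ n)%g = 1%g /\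
      exists x, (rho (u ^+ i) * rho x)%g <> (rho x * rho (u ^+ i))%g.
Proof.
move=> u1 n1 X2; have [T0 [step [stepK un ucom ui]]] := central_rep u1 n1.
pose Z := 'Z_n.+1; exists (T0 * Z)%type => i /[dup] /ui[t1 t1i] /andP[i0 _].
apply: contrapT => central; pose zeta t := wact step t (u ^+ i)%g.
have zetaC t b : zeta (step t b) = step (zeta t) b.
  rewrite /zeta; elim: i {i0 t1i central zeta} t => [|i IH] t; first by rewrite !wact1.
  by rewrite !expgS !wactM // ucom IH.
pose coch (v : {ffun X -> {ffun T0 -> Z}}) (e : T0 * X) : Z := v e.2 e.1.
pose I v t s := wsum step (coch v) t s.
pose Dl (y : {ffun T0 -> Z}) : {ffun T0 -> Z} := [ffun t => y (zeta t) - y t].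
pose V := [set Dl y | y in [set: {ffun T0 -> Z}]]%SET.
have IDl (y v : {ffun X -> {ffun T0 -> Z}}) t s : (forall x, v x = Dl (y x)) ->
    I v t s = I y (zeta t) s - I y t s.
  move=> vE; elim: s t => [|b s IH] t; first by rewrite /I /wsum /= subrr.
  rewrite /I !wsum_cons -/(I v _ s) IH -zetaC /I.
  suff -> : letter_coch step (coch v) t b = letter_coch step (coch y) (zeta t) b - letter_coch step (coch y) t b.
    by rewrite opprD addrACA.
  rewrite /letter_coch /letter_edge /coch; case: b => x [] /=; rewrite vE ffunE //.
  by rewrite zetaC opprD.
pose psi v : {ffun T0 -> Z} := [ffun t => I v t (u ^+ i)%g].
have lift v : v \in ffun_on (mem V) -> exists y : {ffun X -> {ffun T0 -> Z}}, forall x, v x = Dl (y x).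
  move=> /ffun_onP vV; have /choice[y yE] x : exists z, v x = Dl z.
    by have /imsetP[z _ ->] := vV x; exists z.
  by exists [ffun x => y x] => x; rewrite ffunE.
have psiV v : v \in ffun_on (mem V) -> psi v \in V.
  move=> /lift[y yE]; apply/imsetP; exists (psi y) => //.
  by apply/ffunP => t; rewrite !ffunE (IDl y).
have psiE v : v \in ffun_on (mem V) -> forall x t,
    psi v t + v x (zeta t) = v x t + psi v (step t (x, true)).
  move=> vV x t; have [y yE] := lift v vV.
  pose rho := perm_rep (istepK stepK (coch v)).
  have rhoE s t' c : rho s (t', c) = (wact step t' s, c + I v t' s).
    by rewrite /rho perm_repE wact_istep.
  have rn : rho (u ^+ n)%g = 1%g.
    apply/permP => -[t' c]; rewrite rhoE perm1 un (IDl y) //.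
    have := wsumM stepK (coch y) t' (u ^+ i)%g (u ^+ n)%g.
    rewrite -expgnDr addnC expgnDr wsumM // un addrC => /addrI E.
    by rewrite /I E subrr addr0.
  have rc z : (rho (u ^+ i) * rho z)%g = (rho z * rho (u ^+ i))%g.
    by apply: contrapT => ne; apply: central; exists rho; split=> //; exists z.
  have /permP/(_ (t, 0))/(congr1 snd) := rc (spell [:: (x, true)]).
  rewrite !permM !rhoE /= !add0r /psi !ffunE.
  have Ix t' : I v t' [:: (x, true)] = v x t'.
    by rewrite /I wsum_cons /wsum /= addr0.
  by rewrite !Ix.
have psi_inj : {in ffun_on (mem V) &, injective psi}.
  move=> v v' vV vV' E; apply/ffunP => x; apply/ffunP => t.
  have [y yE] := lift v vV; have [y' yE'] := lift v' vV'.
  pose w t := v x t - v' x t; pose z t := y x t - y' x t.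
  have wE t' : w t' = z (zeta t') - z t'.
    by rewrite /w /z yE yE' !ffunE; ring.
  have wz t' : w (zeta t') = w t'.
    have := psiE v vV x t'; have := psiE v' vV' x t'; rewrite E => E1 E2.
    rewrite /w; transitivity (psi v' t' + v x (zeta t') - (psi v' t' + v' x (zeta t'))).
      by ring.
    by rewrite E1 E2; ring.
  have wn : w t *+ n = 0.
    have H k : w t *+ k = z (iter k zeta t) - z t.
      elim: k => [|k IH]; first by rewrite subrr.
      rewrite mulrSr IH; have -> : w t = w (iter k zeta t).
        by elim: k {IH} => //= k ->; rewrite wz.
      by rewrite wE /=; ring.
    rewrite H; have -> : iter n zeta t = t; last by rewrite subrr.
    have -> : iter n zeta t = wact step t ((u ^+ i) ^+ n)%g.
      by elim: (n) => [|k IH]; rewrite ?wact1 // expgSr wactM // -IH.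
    rewrite -expgM mulnC expgM.
    by elim: (i) => [|k IH]; rewrite ?wact1 // expgS wactM // un.
  apply/eqP; rewrite -subr_eq0 -/(w t); apply/eqP.
  rewrite -[LHS]addr0 -wn -mulrS -mulr_natr.
  by rewrite (_ : n.+1%:R = 0) ?mulr0 //; apply: pchar_Zp; apply: ltnW.
have leV : (#|V| ^ #|X| <= #|V|)%N.
  rewrite -card_ffun_on -(card_in_imset psi_inj); apply: subset_leq_card.
  by apply/fintype.subsetP => _ /imsetP[v vV ->]; apply: psiV.
have V2 : (1 < #|V|)%N.
  pose y : {ffun T0 -> Z} := [ffun t => (t == t1)%:R].
  rewrite (cardD1 (Dl 0)) (cardD1 (Dl y)) !inE !imset_f // andbT.
  suff -> : Dl y != Dl 0 by [].
  apply/eqP => /ffunP/(_ t1); rewrite !ffunE eqxx (introF eqP t1i) subr0.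
  by move/eqP; rewrite sub0r oppr_eq0 oner_eq0.
have := leq_trans (leq_pexp2l (ltnW V2) X2) leV.
by rewrite expnS expn1; nia.
Qed.

Local Close Scope ring_scope.
Local Close Scope fset_scope.

(** * Coset graphs of finitely generated subgroups *)

Local Open Scope classical_set_scope.
Local Open Scope group_scope.

Section Generated.
Variable F : groupType.

(** The subgroup generated by S. *)
Definition generated (S : seq F) : set F := [set y | forall A : set F,
  A 1 -> (forall a b, A a -> A b -> A (a * b)) -> (forall a, A a -> A a^-1) ->
  (forall a, a \in S -> A a) -> A y].

Lemma generated1 S : generated S 1. Proof. by []. Qed.
Lemma generatedM S a b : generated S a -> generated S b -> generated S (a * b).
Proof. by move=> Sa Sb A A1 AM AV AS; apply: (AM); [apply: Sa|apply: Sb]. Qed.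
Lemma generatedV S a : generated S a -> generated S a^-1.
Proof. by move=> Sa A A1 AM AV AS; apply: (AV); apply: Sa. Qed.
Lemma generated_in S a : a \in S -> generated S a.
Proof. by move=> Sa A A1 AM AV; apply. Qed.
Lemma generated_sub S T : (forall a, a \in S -> generated T a) -> generated S `<=` generated T.
Proof. by move=> ST y; apply; [apply: generated1|apply: generatedM|apply: generatedV|]. Qed.

Lemma ncl_generated (r y : F) : normal_closure [set r] y ->
  exists ks : seq F, generated [seq r ^ k | k <- ks] y.
Proof.
move=> H; apply: (H [set z | exists ks, generated [seq r ^ k | k <- ks] z]); split; last first.
  by move=> _ ->; exists [:: 1]; apply: generated_in; rewrite /= conjg1 mem_head.
split; first split.
- by apply/mem_set; exists [::]; apply: generated1.
- move=> x z /set_mem[kx Sx] /set_mem[kz Sz]; apply/mem_set; exists (kx ++ kz).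
  rewrite map_cat; apply: generatedM; [move: Sx|apply: generatedV; move: Sz];
    by apply: generated_sub => a Sa; apply: generated_in; rewrite mem_cat Sa ?orbT.
- move=> x /set_mem[kx Sx] z; apply/mem_set; exists [seq k * z | k <- kx].
  suff: generated [seq r ^ k | k <- kx] `<=` [set u | generated [seq r ^ k | k <- [seq k * z | k <- kx]] (u ^ z)].
    exact.
  move=> u; apply=> /=.
  + by rewrite conj1g; apply: generated1.
  + by move=> a b; rewrite conjMg; apply: generatedM.
  + by move=> a; rewrite conjVg; apply: generatedV.
  + move=> _ /mapP[k kk ->]; rewrite -conjgM; apply: generated_in.
    by apply/mapP; exists (k * z) => //; apply: map_f.
Qed.

End Generated.

Section Schreier.
Variable X : countType.
Notation F := (freeGroup X).
Notation letter := (X * bool)%type.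
Notation Om := (set F).

(** Cosets of subgroups are represented as subsets of the free group, on which it acts by
    right translations. *)
Definition cstep (A : Om) (b : letter) : Om := [set z | A (z * (spell [:: b])^-1)].

Lemma cstepK A b : cstep (cstep A b) (invl b) = A.
Proof. by apply/funext => z; rewrite /cstep /mkset spell_inv invgK mulgK. Qed.

Definition translate (A : Om) (u : F) : Om := [set z | A (z * u^-1)].

Lemma wact_translate A s : wact cstep A s = translate A (spell s).
Proof.
elim: s A => [|b s IH] A /=.
  by apply/funext => z; rewrite /translate /mkset spell_nil invg1 mulg1.
by rewrite IH spell_cons; apply/funext => z; rewrite /translate /cstep /mkset invgM mulgA.
Qed.

Lemma cstepE A b : cstep A b = translate A (spell [:: b]).
Proof. exact: (wact_translate A [:: b]). Qed.

Lemma translateM A u v : translate A (u * v) = translate (translate A u) v.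
Proof. by apply/funext => z; rewrite /translate /mkset invgM mulgA. Qed.

Lemma translate1 A : translate A 1 = A.
Proof. by apply/funext => z; rewrite /translate /mkset invg1 mulg1. Qed.

Section Integral.
Variables (Z : zmodType) (c : Om * X -> Z).

Definition integ := wsum cstep c.

Lemma integ_spell v s : integ v (spell s) = integ v s.
Proof. exact/wsum_spell/cstepK. Qed.

Lemma integ_cat v s t : integ v (s ++ t) = (integ v s + integ (translate v (spell s)) t)%R.
Proof. by rewrite -wact_translate; apply: wsum_cat. Qed.

Lemma integM v (x y : F) : integ v (x * y)%g = (integ v x + integ (translate v x) y)%R.
Proof. by rewrite -[in translate v x](spell_val x) -wact_translate; apply/wsumM/cstepK. Qed.

Lemma integ1 v : integ v (1%g : F) = 0%R. Proof. by []. Qed.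

Lemma integV v (x : F) : integ (translate v x) x^-1%g = (- integ v x)%R.
Proof. by apply/eqP; rewrite -addr_eq0 addrC -integM mulgV. Qed.

Lemma integ_conj v (x k : F) : translate v (x ^ k) = v ->
  integ v (x ^ k)%g = integ (translate v k^-1) x.
Proof.
rewrite /conjg => E; rewrite mulgA !integM.
have {}E : translate v (k^-1 * x) = translate v k^-1.
  by rewrite -[in RHS]E -translateM mulgA mulgK.
rewrite E addrC addrA; have := integV (translate v k^-1) k.
rewrite -translateM mulVg translate1 => ->.
by rewrite subrr add0r.
Qed.

End Integral.

Section Loops.
Variable w : seq letter.
Notation l := (size w).
Notation W := (spell w).
Notation nx := (nxt cstep (wletter (w := w))).
Notation pe := (pair_edge cstep (wletter (w := w))).
Hypothesis l_gt0 : (0 < l)%N.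
Definition i0 : 'I_l := Ordinal l_gt0.

Lemma iter_next_take v j : (j <= l)%N ->
  iter j nx (v, i0) = (translate v (spell (take j w)), Ordinal (ltn_pmod j l_gt0)).
Proof.
elim: j => [|j IH] lj.
  by rewrite take0 spell_nil translate1; congr (_, _); apply: val_inj; rewrite /= mod0n.
rewrite iterS IH ?(ltnW lj) // /nxt /=; set i := Ordinal _.
have ij : i = j :> nat by rewrite /= modn_small.
rewrite (take_nth (wletter i)) // -cats1 spell_cat translateM -[in RHS](wact_translate _ [:: _]) /=.
rewrite -ij -(wletter_nth (wletter i)); congr (_, _).
by apply: val_inj; rewrite /= -addn1 modnDml addn1.
Qed.

Lemma iter_next_pow v m : iter (m * l) nx (v, i0) = (translate v (W ^+ m), i0).
Proof.
elim: m v => [|m IH] v; first by rewrite expg0 translate1.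
rewrite mulSnr iterD iter_next_take // take_size.
have -> : Ordinal (ltn_pmod l l_gt0) = i0 by apply: val_inj; rewrite /= modnn.
by rewrite IH expgS translateM.
Qed.

Lemma iter_next_size v : iter l nx (v, i0) = (translate v W, i0).
Proof. by have := iter_next_pow v 1; rewrite mul1n. Qed.

Lemma iter_pos0 v j q : iter j nx (v, i0) = (q, i0) ->
  exists m, j = (m * l)%N /\ q = translate v (W ^+ m).
Proof.
move=> E; have /(congr1 (@nat_of_ord l)) := congr1 snd E.
rewrite (iter_pos _ _ _ (v, i0)) /= add0n => /eqP /dvdnP[m jE].
by exists m; split=> //; move: E; rewrite jE iter_next_pow => -[].
Qed.

Lemma sum_pcl_pow (Z : zmodType) (c : Om * X -> Z) v m :
  (\sum_(j < m * l) pair_coch cstep (wletter (w := w)) c (iter j nx (v, i0)) = integ c v (W ^+ m)%g)%R.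
Proof.
elim: m v => [|m IH] v; first by rewrite mul0n big_ord0 expg0.
rewrite mulSn big_split_ord expgS integM integ_spell /=; congr (_ + _)%R; last first.
  rewrite -IH; apply: eq_bigr => j _; rewrite addnC iterD.
  by rewrite iter_next_size.
suff H j : (j <= l)%N -> (\sum_(k < j) pair_coch cstep (wletter (w := w)) c (iter k nx (v, i0)) =
    integ c v (take j w))%R by rewrite H // take_size.
elim: j => [|j IHj] lj; first by rewrite big_ord0 take0.
rewrite big_ord_recr /= IHj ?(ltnW lj) // iter_next_take ?(ltnW lj) //.
set i := Ordinal _; have ij : i = j :> nat by rewrite /= modn_small.
rewrite (take_nth (wletter i)) // -cats1 integ_cat; congr (_ + _)%R.
by rewrite /integ /wsum /= add0r -ij -(wletter_nth (wletter i)) /pair_coch /=.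
Qed.

Fixpoint pathE v (s : seq letter) : seq (Om * X) :=
  if s is b :: s' then letter_edge cstep v b :: pathE (cstep v b) s' else [::].

Lemma pathE_cat v s t : pathE v (s ++ t) = pathE v s ++ pathE (translate v (spell s)) t.
Proof.
rewrite -wact_translate; elim: s v => //= b s IH v.
by rewrite IH.
Qed.

Lemma pathE_pow v m j : (j < m * l)%N ->
  pe (iter j nx (v, i0)) \in pathE v (flatten (nseq m w)).
Proof.
elim: m v j => // m IH v j; rewrite mulSn /= pathE_cat mem_cat.
have [lj|lj] := ltnP j l => lt; last first.
  rewrite -(subnK lj) iterD iter_next_size IH ?orbT //.
  by rewrite ltn_subLR.
rewrite iter_next_take ?(ltnW lj) //.
have -> : pathE v w = pathE v (take j w ++ drop j w) by rewrite cat_take_drop.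
set i := Ordinal _; have ij : i = j :> nat by rewrite /= modn_small.
rewrite pathE_cat mem_cat (drop_nth (wletter i)) //= inE.
rewrite {2}/pair_edge /= -[in nth _ _ _]ij -(wletter_nth (wletter i)).
by rewrite -[in X in X || _]ij eqxx orbT.
Qed.

End Loops.
End Schreier.

(** * Torsion in one-relator groups *)

Lemma expgV_finite (G : groupType) (x : G) n k : (0 < n)%N -> x ^+ n = 1 ->
  (x ^+ k)^-1 = x ^+ (k * n.-1).
Proof.
case: n => // n _ xn; apply: (mulgI (x ^+ k)).
by rewrite mulgV -expgnDr -mulnS mulnC expgM xn expg1n.
Qed.

Section Torsion.
Variable X : countType.
Notation F := (freeGroup X).
Notation letter := (X * bool)%type.
Notation Om := (set F).
Variable w : seq letter.
Notation l := (size w).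
Notation W := (spell w).
Hypothesis l_gt0 : (0 < l)%N.
Hypothesis w_red : reduced (w ++ w).
Hypothesis w_prim : forall i, (0 < i < l)%N -> rot i w <> w.
Notation nx := (nxt (@cstep X) (wletter (w := w))).
Notation inD := (cycle_in (@cstep X) (wletter (w := w))).
Notation perw := (period (@cstep X) (wletter (w := w))).
Notation i0 := (i0 l_gt0).

Section Label.
Variables (G : groupType) (pi : {multiplicative F -> G}).
Let phi x := pi (spell [:: (x, true)]).

Lemma label_pow v m : label (@cstep X) (wletter (w := w)) phi (v, i0) (m * l) = pi W ^+ m.
Proof.
rewrite /label; elim: m v => [|m IH] v; first by rewrite mul0n big_ord0 expg0.
rewrite mulSn big_split_ord expgS /=; congr (_ * _); last first.
  rewrite -(IH (translate v W)); apply: eq_bigr => j _; rewrite addnC iterD.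
  by rewrite iter_next_size.
suff H j : (j <= l)%N -> \prod_(k < j) letter_val phi (wletter (iter k nx (v, i0)).2) = pi (spell (take j w)).
  by rewrite H // take_size.
elim: j => [|j IHj] lj; first by rewrite big_ord0 take0 spell_nil hom1.
rewrite big_ord_recr /= IHj ?(ltnW lj) // iter_next_take ?(ltnW lj) //.
set i := Ordinal _; have ij : i = j :> nat by rewrite /= modn_small.
rewrite (take_nth (wletter i)) // -cats1 spell_cat gmulfM hom_letter_val; congr (_ * _).
by rewrite -ij -(wletter_nth (wletter i)).
Qed.

Lemma potential_path (f : Om -> G) (D : {fset Om * X}) v s :
  (forall e, e \in D -> f (tgt (@cstep X) e) = f e.1 * phi e.2) ->
  {subset pathE v s <= D} -> f (translate v (spell s)) = f v * pi (spell s).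
Proof.
move=> fE; rewrite -wact_translate; elim: s v => [|b s IH] v sD /=.
  by rewrite spell_nil hom1 mulg1.
rewrite IH => [|e es]; last by rewrite sD //= inE es orbT.
rewrite spell_cons gmulfM mulgA; congr (_ * _).
have := fE _ (sD _ (mem_head _ _)).
rewrite hom_letter_val /letter_val /letter_edge /tgt; case: b {sD} => x [] //=.
by rewrite (cstepK v (x, false)) => ->; rewrite mulgK.
Qed.

End Label.

(** A finite graph of cosets of E, given by paths ps that read a word from a coset. *)
Section Subgraph.
Variables (S : seq F) (ps : seq (F * seq letter)).
Let E := generated S.

Definition pgraph : {fset Om * X} :=
  [fset e in flatten [seq pathE (translate E t.1) t.2 | t <- ps]]%fset.

Lemma coset_eq x y : translate E x = translate E y <-> E (x * y^-1).
Proof.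
split=> [/(congr1 (@^~ x))|Exy].
  by rewrite /translate /mkset /= mulgV => <-; apply: generated1.
apply/funext => z; apply/propext; rewrite /translate /mkset; split=> Ez.
  have := generatedM Ez Exy; by rewrite -mulgA mulKg.
have := generatedM Ez (generatedV Exy); by rewrite invgM invgK -mulgA mulKg.
Qed.

Lemma pgraph_path y s : (y, s) \in ps -> {subset pathE (translate E y) s <= pgraph}.
Proof.
move=> yps e es; rewrite !inE; apply/flattenP.
exists (pathE (translate E y) s) => //.
exact: (map_f (fun t => pathE (translate E t.1) t.2) yps).
Qed.

Lemma pathE_src y s e : e \in pathE (translate E y) s -> exists y', e.1 = translate E y'.
Proof.
elim: s y => //= b s IH y; rewrite cstepE -translateM inE => /orP[/eqP->|/IH //].
rewrite /letter_edge; case: ifP => _ /=; first by exists y.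
by exists (y * spell [:: b]); rewrite translateM -cstepE.
Qed.

Lemma pgraph_src e : e \in pgraph -> exists y, e.1 = translate E y.
Proof.
rewrite !inE => /flattenP[s /mapP[t _ ->]]; exact: pathE_src.
Qed.

Lemma cycle_in_src p : inD pgraph p -> exists y, p.1 = translate E y.
Proof.
move=> /cycle_in_edge /pgraph_src[y]; case h: (wletter p.2).2.
  by have [-> _] := @pair_edge_fwd _ _ _ (@cstep X) _ _ h; exists y.
move/negbT in h; have [-> _] := pair_edge_bwd (@cstepK X) h => Ey.
exists (y * spell [:: invl (wletter p.2)]); rewrite translateM -cstepE -Ey.
by rewrite cstepK.
Qed.

Lemma cycle_in_loop y m : (0 < m)%N -> (y, flatten (nseq m w)) \in ps ->
  translate E (y * W ^+ m) = translate E y -> inD pgraph (translate E y, i0).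
Proof.
move=> m0 yps yE; apply/asboolP => j; rewrite (divn_eq j (m * l)) addnC iterD.
have -> k : iter (k * (m * l)) nx (translate E y, i0) = (translate E y, i0).
  elim: k => // k IH; rewrite mulSn iterD IH iter_next_pow.
  by rewrite -translateM yE.
apply: (pgraph_path yps); apply: pathE_pow.
by rewrite ltn_mod muln_gt0 m0.
Qed.

Lemma integ_loop (Z : zmodType) (c : Om * X -> Z) y m :
  translate E (y * W ^+ m) = translate E y ->
  integ c (translate E y) (W ^+ m)%g =
    (cycle_sum (@cstep X) (wletter (w := w)) c (translate E y, i0) *+ (m * l %/ perw (translate E y, i0)))%R.
Proof.
move=> yE; rewrite -(sum_pcl_pow l_gt0) sum_period //.
by rewrite iter_next_pow -translateM yE.
Qed.

Lemma integ_conj_loop (Z : zmodType) (c : Om * X -> Z) k m : E (W ^+ m ^ k) ->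
  integ c (translate E 1) (W ^+ m ^ k)%g =
    (cycle_sum (@cstep X) (wletter (w := w)) c (translate E k^-1%g, i0)
       *+ (m * l %/ perw (translate E k^-1%g, i0)))%R.
Proof.
move=> Ek; rewrite integ_conj -?translateM ?mul1g ?integ_loop //.
  by apply/coset_eq; rewrite invgK -mulgA.
by apply/coset_eq; rewrite invg1 mulg1.
Qed.

Lemma cycle_in_conj_loop k m : (0 < m)%N -> (k^-1, flatten (nseq m w)) \in ps ->
  E (W ^+ m ^ k) -> inD pgraph (translate E k^-1, i0).
Proof.
move=> m0 kps Ek; apply: (cycle_in_loop m0 kps).
by apply/coset_eq; rewrite invgK -mulgA.
Qed.

(** A cochain that vanishes on the generators of E, as loops at the trivial coset, derives from
    the potential given by integration along any path from the trivial coset. *)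
Lemma cycles_span_pgraph :
  (forall c : Om * X -> rat,
    (forall p, inD pgraph p -> cycle_sum (@cstep X) (wletter (w := w)) c p = 0%R) ->
    forall s, s \in S -> integ c (translate E 1) s = 0%R) ->
  cycles_span (@cstep X) (wletter (w := w)) pgraph.
Proof.
move=> H c /H {}H; pose v0 := translate E 1.
have cE y : E y -> integ c v0 y = 0%R.
  suff : E `<=` [set y | translate v0 y = v0 /\ integ c v0 y = 0%R] by move=> /(_ y) /[apply] -[].
  move=> u; apply => /=.
  - by rewrite translate1 integ1.
  - by move=> a b [Ea ca] [Eb cb]; rewrite translateM Ea Eb integM ca Ea cb addr0.
  - move=> a [Ea ca]; have Ea' : translate v0 a^-1 = v0 by rewrite -[in LHS]Ea -translateM mulgV translate1.
    by split=> //; have := integV c v0 a; rewrite Ea ca oppr0.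
  - move=> a Sa; split; last exact: H.
    by rewrite -translateM mul1g; apply/coset_eq; rewrite invg1 mulg1; apply: generated_in.
have cwd x y : translate E x = translate E y -> integ c v0 x = integ c v0 y.
  move=> /coset_eq Exy; rewrite -[x](mulgKV y) integM cE // add0r.
  by rewrite -translateM mul1g (coset_eq _ 1).2 // invg1 mulg1.
pose f v := integ c v0 (xget 1 [set y | v = translate E y]).
have fE y : f (translate E y) = integ c v0 y.
  by rewrite /f; case: xgetP => [z _ /cwd //|/(_ y)/=[]].
exists f => e /pgraph_src[y ey]; rewrite /tgt ey cstepE -translateM !fE.
rewrite integM addrC addKr -translateM mul1g /integ /wsum /= add0r /letter_coch /= /letter_edge /=.
by rewrite -ey -surjective_pairing.
Qed.

End Subgraph.

Variables (G : groupType) (pi : {multiplicative F -> G}) (n : nat).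
Hypothesis n_gt0 : (0 < n)%N.
Hypothesis pi_surj : forall g : G, exists u : F, pi u = g.
Hypothesis pi_ker : forall u : F, pi u = 1 -> normal_closure [set W ^+ n] u.
Hypothesis pi_r : pi W ^+ n = 1.
Notation om := (pi W).

Let rks ks := [seq W ^+ n ^ k | k <- ks].

Let relator_paths (ks : seq F) := [seq (k^-1, flatten (nseq n w)) | k <- ks].

(** The integral of c along a loop in the subgroup generated by conjugates of the relator is a
    sum of multiples of cycle sums of c. *)
Lemma integ_relators (Z : zmodType) S ps ks (c : Om * X -> Z) (A : {pred Z}) :
  (A 0%R) -> (forall x y, A x -> A y -> A (x + y)%R) -> (forall x, A x -> A (- x)%R) ->
  {subset rks ks <= S} -> {subset relator_paths ks <= ps} ->
  (forall p, inD (pgraph S ps) p ->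
     A (cycle_sum (@cstep X) (wletter (w := w)) c p *+ (n * l %/ perw p))%R) ->
  forall y, generated (rks ks) y -> A (integ c (translate (generated S) 1) y).
Proof.
move=> A0 AD AN kS kps Acyc; set v0 := translate _ 1.
suff : generated (rks ks) `<=` [set y | translate v0 y = v0 /\ A (integ c v0 y)].
  by move=> H y /H[].
move=> u; apply => /=.
- by rewrite translate1 integ1.
- by move=> a b [Ea ca] [Eb cb]; rewrite translateM Ea Eb integM Ea; split=> //; apply: AD.
- move=> a [Ea ca]; have Ea' : translate v0 a^-1 = v0 by rewrite -[in LHS]Ea -translateM mulgV translate1.
  by split=> //; have := integV c v0 a; rewrite Ea => ->; apply: AN.
move=> a kka; have Sa := generated_in (kS _ kka); split.
  by rewrite -translateM mul1g; apply/coset_eq; rewrite invg1 mulg1.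
move: kka Sa => /mapP[k kk ->] Sa; rewrite integ_conj_loop //; apply: Acyc.
apply: cycle_in_conj_loop n_gt0 _ Sa; apply: kps.
exact: (map_f (fun k => (k^-1, flatten (nseq n w)))).
Qed.

Let rks_pi ks y : generated (rks ks) y -> pi y = 1.
Proof.
move=> H; apply: (H [set z | pi z = 1]) => /=; first by rewrite hom1.
- by move=> a b; rewrite gmulfM => -> ->; rewrite mulg1.
- by move=> a; rewrite homV => ->; rewrite invg1.
by move=> _ /mapP[k _ ->]; rewrite homJ homX pi_r conj1g.
Qed.

(** If all cycles of the graph had trivial image in G, then the letters would derive from a
    potential with values in G, and the loop u would have trivial image.  A cycle with
    nontrivial image is a power of w, and is conjugate to an element of the image of E, which
    is the group of order p generated by g. *)
Theorem torsion_conj g p : prime p -> g ^+ p = 1 -> g <> 1 ->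
  exists x j, g = om ^+ j ^ x.
Proof.
move=> p_pr gp g1; have [u ug] := pi_surj g.
have [ks uks] : exists ks, generated (rks ks) (u ^+ p).
  by apply: ncl_generated; apply: pi_ker; rewrite homX ug.
pose S := u :: rks ks; pose E := generated S.
pose ps := (1, fword u) :: relator_paths ks.
have kS : {subset rks ks <= S} by move=> a ka; rewrite inE ka orbT.
have kps : {subset relator_paths ks <= ps} by move=> a ka; rewrite inE ka orbT.
have Eu : translate (translate E 1) u = translate E 1.
  by rewrite -translateM mul1g; apply/coset_eq; rewrite invg1 mulg1; exact: generated_in (mem_head _ _).
have VD : cycles_span (@cstep X) (wletter (w := w)) (pgraph S ps).
  apply: cycles_span_pgraph => c c0.
  have cks y : generated (rks ks) y -> integ c (translate E 1) y = 0%R.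
    move=> yk; apply/eqP.
    apply: (@integ_relators _ S ps ks c (pred1 0%R)) yk => //=.
    - by move=> x z /eqP-> /eqP->; rewrite addr0.
    - by move=> x /eqP->; rewrite oppr0.
    - by move=> q /c0 ->; rewrite mul0rn.
  have cuX m : integ c (translate E 1) (u ^+ m) = (integ c (translate E 1%g) u *+ m)%R.
    by elim: m => // m IH; rewrite expgS integM Eu IH mulrS.
  move=> s; rewrite inE => /orP[/eqP->|sk]; last exact: cks (generated_in sk).
  apply/eqP; have := cuX p; rewrite cks // => /esym/eqP.
  by rewrite mulrn_eq0 gtn_eqF ?prime_gt0.
have Eg e : E e -> exists i, pi e = g ^+ i.
  move=> H; apply: (H [set z | exists i, pi z = g ^+ i]) => /=; first by exists 0%N; rewrite hom1.
  - by move=> a b [i ai] [j bj]; exists (i + j)%N; rewrite gmulfM ai bj expgnDr.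
  - move=> a [i ai]; exists (i * p.-1)%N; by rewrite homV ai (expgV_finite _ (prime_gt0 p_pr)).
  - move=> s; rewrite inE => /orP[/eqP->|sk]; first by exists 1%N; rewrite ug.
    by exists 0%N; apply: (@rks_pi ks); apply: generated_in.
have [lab1|] := pselect (forall q, inD (pgraph S ps) q ->
    label (@cstep X) (wletter (w := w)) (fun x => pi (spell [:: (x, true)])) q (perw q) = 1).
  have [f fE] := label_potential (@cstepK X) (@wrank_inj _ _ w_red w_prim)
    (@wletter_red _ _ w_red) (wrank_same w_red w_prim) (wrank_opp w_red w_prim) VD lab1.
  have := potential_path fE (@pgraph_path S ps 1 u (mem_head _ _)).
  rewrite spell_val Eu ug => /esym E1; case: g1.
  by apply: (mulgI (f (translate E 1))); rewrite E1 mulg1.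
move=> /existsNP[q /not_implyP[Dq labq]].
have [j jE] := hit_pos (@cstep X) (wletter (w := w)) q i0.
have Dj := cycle_in_iter j Dq; have [y yE] := cycle_in_src Dj.
have qE : iter j nx q = (translate E y, i0) by rewrite -jE -yE -surjective_pairing.
have perE : perw q = perw (translate E y, i0).
  rewrite -qE; elim: (j) => //= k IHk; rewrite period_next //; exact: cstepK.
have [per0 perK] := periodP (@cstepK X) Dj.
rewrite qE -perE in per0 perK.
have [m [mE Em]] := iter_pos0 perK.
have Wm1 : om ^+ m <> 1.
  rewrite -(label_pow pi (translate E y)) -mE => lab; apply: labq.
  by apply: (@label_iter _ _ _ _ (@cstepK X) _ _ _ _ _ j Dq); rewrite qE.
move: Em; rewrite -translateM => /coset_eq/generatedV.
rewrite invgM invgK => /Eg[i iE].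
have {}iE : om ^+ m = (g ^+ i) ^ pi y.
  by rewrite -iE !gmulfM homV homX /conjg !mulgA mulVg mul1g mulgKV.
have ip : coprime p i.
  rewrite prime_coprime //; apply/negP => /dvdnP[k kE]; apply: Wm1.
  by rewrite iE kE mulnC expgM gp expg1n conj1g.
have [k kE] : exists k, (i * k = 1 %[mod p])%N.
  exists (i ^ (totient p).-1)%N.
  by rewrite -expnS prednK ?totient_gt0 ?prime_gt0 // cyclic.Euler_exp_totient // coprime_sym.
exists (pi y)^-1, (m * k)%N.
rewrite expgM iE -conjXg conjgK -expgM (divn_eq (i * k) p) kE.
by rewrite modn_small ?prime_gt1 // expgnDr mulnC expgM gp expg1n mul1g.
Qed.

(** If the cycles of e1 and e2 were distinct, integrate along e1 * e2^-1 a cochain c that is 1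
    on the former and 0 on the others.  If the former reads w ^+ m, this gives i / m, and this
    must be a multiple of n / m by [integ_relators]; so n divides i, and om ^+ i = 1. *)
Theorem malnormal x i j : om ^+ i <> 1 -> om ^+ j ^ x = om ^+ i -> exists m, x = om ^+ m.
Proof.
move=> i1 jx; have [xi xiE] := pi_surj x.
pose e1 := W ^+ i; pose e2 := W ^+ j ^ xi.
have i_gt0 : (0 < i)%N by rewrite lt0n; apply: contra_notN i1 => /eqP->.
have j_gt0 : (0 < j)%N.
  by rewrite lt0n; apply: contra_notN i1 => /eqP j0; rewrite -jx j0 expg0 conj1g.
(* With 1 among the conjugators, E contains the relator itself, so that m divides n below. *)
have [ks [ks1 eks]] : exists ks, 1 \in ks /\ generated (rks ks) (e1 * e2^-1).
  have [|ks eks] := @ncl_generated F (W ^+ n) (e1 * e2^-1).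
    by apply: pi_ker; rewrite gmulfM homV homJ !homX xiE jx mulgV.
  exists (1 :: ks); split; first exact: mem_head.
  by apply: generated_sub eks => a ka; apply: generated_in; rewrite inE ka orbT.
pose S := e1 :: e2 :: rks ks; pose E := generated S.
pose ps := (1^-1, flatten (nseq i w)) :: (xi^-1, flatten (nseq j w)) :: relator_paths ks.
have kS : {subset rks ks <= S} by move=> a ka; rewrite !inE ka !orbT.
have kps : {subset relator_paths ks <= ps} by move=> a ka; rewrite !inE ka !orbT.
have Ee1 : E (W ^+ i ^ 1) by rewrite conjg1; apply: generated_in; rewrite mem_head.
have Ee2 : E e2 by apply: generated_in; rewrite !inE eqxx orbT.
set p1 := (translate E 1^-1, i0); set p2 := (translate E xi^-1, i0).
have D1 : inD (pgraph S ps) p1 by apply: cycle_in_conj_loop i_gt0 _ Ee1; rewrite mem_head.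
have D2 : inD (pgraph S ps) p2.
  by apply: cycle_in_conj_loop j_gt0 _ Ee2; rewrite !inE eqxx orbT.
have int1 (Z : zmodType) (c : Om * X -> Z) : integ c (translate E 1) e1 =
    (cycle_sum (@cstep X) (wletter (w := w)) c p1 *+ (i * l %/ perw p1))%R.
  by rewrite -(integ_conj_loop c Ee1) conjg1.
have int2 (Z : zmodType) (c : Om * X -> Z) : integ c (translate E 1) e2 =
    (cycle_sum (@cstep X) (wletter (w := w)) c p2 *+ (j * l %/ perw p2))%R.
  by rewrite -(integ_conj_loop c Ee2).
have VD : cycles_span (@cstep X) (wletter (w := w)) (pgraph S ps).
  apply: cycles_span_pgraph => c c0 s.
  rewrite !inE => /or3P[/eqP->|/eqP->|sk].
  - by rewrite int1 c0 // mul0rn.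
  - by rewrite int2 c0 // mul0rn.
  apply/eqP; apply: (@integ_relators _ S ps ks c (pred1 0%R)) (generated_in sk) => //=.
  - by move=> a b /eqP-> /eqP->; rewrite addr0.
  - by move=> a /eqP->; rewrite oppr0.
  - by move=> q /c0 ->; rewrite mul0rn.
have same : exists t, iter t nx p1 = p2.
  apply: contrapT => diff.
  pose k q : int := (`[< exists t, iter t nx p1 = q >])%:R%R.
  have kN q : inD (pgraph S ps) q -> k (nx q) = k q.
    move=> Dq; congr (_%:R)%R; congr nat_of_bool; apply: asbool_equiv_eq.
    split=> [[t tE]|[t <-]]; last by exists t.+1.
    have [_ [s sE]] := cycle_in_prev (@cstepK X) (cycle_in_iter t D1).
    exists (s + t)%N; rewrite iterD -sE tE; exact: (nextK (@cstepK X)).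
  have [c cE] := cycle_sum_prescribed (@cstepK X) (@wrank_inj _ _ w_red w_prim)
    (@wletter_red _ _ w_red) (wrank_same w_red w_prim) (wrank_opp w_red w_prim) VD kN.
  have c1 : cycle_sum (@cstep X) (wletter (w := w)) c p1 = 1%R.
    by rewrite cE // /k asboolT //; exists 0%N.
  have c2 : cycle_sum (@cstep X) (wletter (w := w)) c p2 = 0%R.
    by rewrite cE // /k (asboolF diff).
  pose q2 : int := (n * l %/ perw p1)%:R%R.
  have : (q2 %| integ c (translate E 1%g) (e1 * e2^-1)%g)%Z.
    apply: (@integ_relators _ S ps ks c (fun z => (q2 %| z)%Z)) eks => //=.
    - by move=> a b; apply: rpredD.
    - by move=> a; rewrite rpredN.
    move=> q Dq; rewrite cE // /k; case: asboolP => [[t <-]|_]; last by rewrite mul0rn.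
    have -> : perw (iter t nx p1) = perw p1.
      by elim: t => //= t IHt; rewrite period_next //; apply: cstepK.
    exact: dvdzz.
  have E1 : translate (translate E 1) e1 = translate (translate E 1) e2.
    rewrite -!translateM !mul1g; apply/coset_eq; apply: generatedM (generatedV Ee2).
    by move: Ee1; rewrite conjg1.
  have E2 : translate (translate E 1) e2 = translate E 1.
    by rewrite -translateM mul1g; apply/coset_eq; rewrite invg1 mulg1.
  rewrite integM E1; have := integV c (translate E 1) e2.
  rewrite E2 => ->; rewrite int1 int2 c1 c2 mul0rn subr0 /q2.
  have [P0 PK] := periodP (@cstepK X) D1.
  have [m [mE _]] := iter_pos0 PK.
  have m_gt0 : (0 < m)%N by move: P0; rewrite mE muln_gt0 => /andP[].
  have dvd_per K : (0 < K)%N -> E (W ^+ K ^ 1) -> (m %| K)%N.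
    move=> K0 EK; have Kp : iter (K * l) nx p1 = p1.
      rewrite iter_next_pow /p1 -translateM; congr (_, _); apply/coset_eq.
      by move: EK; rewrite conjg1 invg1 mul1g invg1 mulg1.
    have := period_dvd Kp; rewrite muln_gt0 K0 l_gt0 mE => /(_ isT).
    by rewrite dvdn_pmul2r.
  have En : E (W ^+ n ^ 1) by apply: generated_in; apply: kS; exact: (map_f (fun k => W ^+ n ^ k) ks1).
  rewrite mE !divnMr // dvdzE !natz !absz_nat => /dvdnP[a aE]; apply: i1.
  rewrite -(divnK (dvd_per _ i_gt0 Ee1)) aE -mulnA divnK ?dvd_per //.
  by rewrite mulnC expgM pi_r expg1n.
have [t tE] := same; have [m [_]] := iter_pos0 tE.
rewrite -translateM => /coset_eq Exi.
have Epi e : E e -> exists a, pi e = om ^+ a.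
  move=> H; apply: (H [set z | exists a, pi z = om ^+ a]) => /=; first by exists 0%N; rewrite hom1.
  - by move=> a b [i' ai] [j' bj]; exists (i' + j')%N; rewrite gmulfM ai bj expgnDr.
  - by move=> a [i' ai]; exists (i' * n.-1)%N; rewrite homV ai (expgV_finite _ n_gt0).
  - move=> s; rewrite !inE => /or3P[/eqP->|/eqP->|sk].
    + by exists i; rewrite homX.
    + by exists i; rewrite homJ homX xiE.
    by exists 0%N; apply: (@rks_pi ks); apply: generated_in.
have [a] := Epi _ Exi; rewrite invg1 mul1g gmulfM !homV homX xiE => aE.
exists ((a + m) * n.-1)%N; rewrite -(expgV_finite _ n_gt0) //.
by apply: invg_inj; rewrite invgK expgnDr -aE mulgKV.
Qed.

End Torsion.

(** * The virtual splitting *)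

Lemma ncl_ker (G H : groupType) (f : {multiplicative G -> H}) (r u : G) :
  f r = 1 -> normal_closure [set r] u -> f u = 1.
Proof.
move=> fr N; apply: (N [set z | f z = 1]); split; last by move=> _ ->.
split; first split.
- by apply/mem_set; rewrite /= hom1.
- by move=> x y /set_mem/= fx /set_mem/= fy; apply/mem_set; rewrite /= gmulfM homV fx fy mulgV.
- by move=> x /set_mem/= fx y; apply/mem_set; rewrite /= homJ fx conj1g.
Qed.

Lemma ncl_conj (G : groupType) (r k u : G) :
  normal_closure [set r ^ k] u -> normal_closure [set r] u.
Proof.
have rN : r \in normal_closure [set r] by apply/mem_set => M [_]; exact.
move=> N; apply: (N (normal_closure [set r])); split; first exact: normal_closureP.
move=> _ ->; apply: set_mem; have [_ J] := normal_closureP [set r].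
exact: J.
Qed.

Section InnerAut.
Variable G : groupType.

Definition inner (x : G) : autg G :=
  Autg (fun a b => conjMg a b x) (Bijective (conjgK x) (conjgKV x)).

Lemma Out_proj_eq (f g : autg G) :
  Out_proj G f = Out_proj G g <-> exists x, forall y, (f^-1 * g) y = y ^ x.
Proof.
split=> [/eqP|[x xE]]; first by rewrite quot_projE => /set_mem.
by apply/eqP; rewrite quot_projE; apply/mem_set; exists x.
Qed.

Lemma Out_proj_inner x (f : autg G) : Out_proj G (inner x * f) = Out_proj G f.
Proof.
rewrite gmulfM; suff -> : Out_proj G (inner x) = 1 by rewrite mul1g.
rewrite -(hom1 (Out_proj G)); apply/Out_proj_eq; exists x^-1 => y.
rewrite mulg1; apply: (can_inj (aut_funK (inner x))).
by rewrite [LHS](aut_invfunK (inner x)) /= conjgKV.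
Qed.

End InnerAut.

Section Splitting.
Variables (X : finType) (w : seq (X * bool)) (N : nat).
Notation F := (freeGroup X).
Notation W := (spell w).
Hypotheses (l_gt0 : 0 < size w) (w_red : reduced (w ++ w)).
Hypothesis w_prim : forall i, 0 < i < size w -> rot i w <> w.
Hypothesis N_gt1 : 1 < N.
Variables (G : groupType) (pi : {multiplicative F -> G}).
Hypothesis pi_surj : forall g : G, exists u : F, pi u = g.
Hypothesis pi_ker : forall u : F, pi u = 1 -> normal_closure [set W ^+ N] u.
Hypothesis pi_r : pi W ^+ N = 1.
Notation om := (pi W).

Let W1 : W <> 1.
Proof.
move=> /(congr1 val); rewrite val_spell; last by case/cat_sorted2: w_red.
by case: (w) l_gt0.
Qed.

Lemma factor_hom (Q : groupType) (rho : {multiplicative F -> Q}) :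
  rho (W ^+ N) = 1 -> exists sigma : {multiplicative G -> Q}, forall u, sigma (pi u) = rho u.
Proof.
move=> rr; have /choice[s sE] := pi_surj.
have wd u v : pi u = pi v -> rho u = rho v.
  move=> E; apply: (mulIg (rho v)^-1); rewrite mulgV -homV -gmulfM.
  by apply: (ncl_ker rr); apply: pi_ker; rewrite gmulfM homV E mulgV.
pose sg g := rho (s g).
have sgM : {morph sg : x y / x * y}.
  by move=> x y; rewrite /sg -gmulfM; apply: wd; rewrite gmulfM !sE.
pose m := isMultiplicative.Build G Q sg sgM.
pose sg' : {multiplicative G -> Q} := HB.pack sg m.
by exists sg' => u; rewrite /= /sg; apply: wd; rewrite sE.
Qed.

Lemma om_order i : 0 < i < N -> om ^+ i <> 1.
Proof.
move=> iN; have [T [step [stepK sn _ si]]] := central_rep W1 N_gt1.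
have [|sigma sE] := @factor_hom _ (perm_rep stepK).
  by apply/permP => t; rewrite perm_repE sn perm1.
have [t st] := si i iN; move=> /(congr1 sigma); rewrite -homX sE hom1.
by move=> /permP/(_ t); rewrite perm_repE perm1.
Qed.

Lemma powers_mod i : om ^+ i = om ^+ (i %% N).
Proof. by rewrite {1}(divn_eq i N) expgnDr mulnC expgM pi_r expg1n mul1g. Qed.

Let om_neq1 : om <> 1. Proof. by rewrite -[om]expg1; apply: om_order. Qed.

(** The image of a power of om of prime order is conjugate to a power of om, and f om commutes
    with it. *)
Lemma aut_om (f : autg G) : exists m x, f om = om ^+ m ^ x.
Proof.
pose p := pdiv N; have p_pr : prime p by apply: pdiv_prime.
have pN : p %| N by apply: pdiv_dvd.
pose q := (N %/ p)%N; have qN : (q * p = N)%N by rewrite divnK.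
have q_gt0 : 0 < q by rewrite divn_gt0 ?prime_gt0 // dvdn_leq // ltnW.
have [||x [j E]] := torsion_conj l_gt0 w_red w_prim (ltnW N_gt1) pi_surj pi_ker pi_r
    (g := f (om ^+ q)) p_pr.
- by rewrite -homX -expgM qN pi_r hom1.
- rewrite -(hom1 f) => /(can_inj (aut_funK f)); apply: om_order.
  by rewrite q_gt0 -qN ltn_Pmulr // prime_gt1.
have j1 : om ^+ j <> 1.
  move=> j1; move: E; rewrite j1 conj1g -(hom1 f) => /(can_inj (aut_funK f)).
  by apply: om_order; rewrite q_gt0 -qN ltn_Pmulr // prime_gt1.
have [|m mE] := malnormal l_gt0 w_red w_prim (ltnW N_gt1) pi_surj pi_ker pi_r
    (x := f om ^ x^-1) (j := j) j1.
  have -> : om ^+ j = f (om ^+ q) ^ x^-1 by rewrite E conjgK.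
  rewrite -conjJg; congr (_ ^ _).
  by rewrite homX conjXg /conjg mulKg.
by exists m, x; rewrite -mE conjgKV.
Qed.

Lemma rank1_abelian : #|X| <= 1 -> forall g h : G, g * h = h * g.
Proof.
move=> /fintype_le1P X1 g h; have [u <-] := pi_surj g; have [v <-] := pi_surj h.
rewrite -!gmulfM; congr (pi _); rewrite -(spell_val u) -(spell_val v).
have letters (a b : X * bool) : spell [:: a] * spell [:: b] = spell [:: b] * spell [:: a] :> F.
  case: a b => x e [y e']; rewrite (X1 y x).
  have [->//|ne] := eqVneq e e'.
  rewrite (_ : (y, e') = invl (y, e)); last by rewrite /invl /=; case: e e' ne => [] [].
  by rewrite spell_inv mulgV mulVg.
have word s b : spell s * spell [:: b] = spell [:: b] * spell s :> F.
  elim: s => [|a s IH]; first by rewrite spell_nil mul1g mulg1.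
  by rewrite (spell_cons a s) -mulgA IH mulgA letters mulgA.
elim: (fword v) => [|b s IH]; first by rewrite spell_nil mul1g mulg1.
by rewrite (spell_cons b s) mulgA word -mulgA IH mulgA.
Qed.

Lemma detect : exists T : finType, forall m,
  (forall (rho : {multiplicative G -> {perm T}}) y, rho (om ^+ m) * rho y = rho y * rho (om ^+ m)) ->
  forall y, y ^ (om ^+ m) = y.
Proof.
have [X2|X1] := leqP 2 #|X|; last first.
  by exists 'I_0 => m _ y; rewrite /conjg (rank1_abelian X1) mulgK.
have [T Tn] := noncentral_rep W1 N_gt1 X2; exists T => m central y.
have [m0|m0] := posnP (m %% N)%N; first by rewrite powers_mod m0 expg0 conjg1.
have [|rho [rn [x nx]]] := Tn (m %% N)%N; first by rewrite m0 ltn_mod ltnW.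
have [sigma sE] := factor_hom rn; case: nx.
by rewrite -!sE homX -powers_mod central.
Qed.

(** Modulo inner automorphisms, f may be replaced by nf f, which maps om to one of its powers.
    The coset of nf f modulo S is determined by this power and by the action of nf f on the
    homomorphisms from G to Q, which form a finite set because they are determined by their
    values on the generators. *)
Theorem Out_splits : splits_virtually (Out_proj G).
Proof.
have [T Tdet] := detect; pose Q := {perm T}.
pose S : set (autg G) := [set f | f om = om /\
  forall (rho : {multiplicative G -> Q}) y, rho (f y) = rho y].
have SV f : S f -> S f^-1.
  move=> [fo fr]; split=> [|rho y].
    by apply: (can_inj (aut_funK f)); rewrite aut_invfunK fo.
  by rewrite -[in RHS](aut_invfunK f y) fr.
have SM f g : S f -> S g -> S (f * g).
  by move=> [fo fr] [go gr]; split=> [|rho y] /=; rewrite ?go ?fo // fr gr.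
have S1 : S 1 by [].
have S_inn f : S f -> (exists x, forall y, f y = y ^ x) -> f = 1.
  move=> [fo fr] [x xE]; apply: autgP => y /=; rewrite xE.
  have [||m mE] := malnormal l_gt0 w_red w_prim (ltnW N_gt1) pi_surj pi_ker pi_r
    (x := x) (i := 1) (j := 1); [by rewrite expg1|by rewrite !expg1 -xE|].
  rewrite mE; apply: Tdet => rho z; rewrite -mE.
  by rewrite [RHS]conjgC -homJ -xE fr.
pose B : set (Out G) := [set Out_proj G f | f in S].
have Bclosed : group_closed (mem B).
  split; first by apply/mem_set; exists 1 => //; rewrite hom1.
  move=> _ _ /set_mem[f Sf <-] /set_mem[g Sg <-]; apply/mem_set.
  by exists (f * g^-1); rewrite ?gmulfM ?homV //; apply: SM => //; apply: SV.
pose B' := Subgroup Bclosed.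
have uniqS f g : S f -> S g -> Out_proj G f = Out_proj G g -> f = g.
  move=> Sf Sg /Out_proj_eq fg; apply: (mulgI f^-1); rewrite mulVg.
  by apply/esym/S_inn => //; apply: SM => //; apply: SV.
have /choice[s sE] (b : subgroup_type B') : exists f, S f /\ Out_proj G f = val b.
  by have /set_mem[f Sf fb] := valP b; exists f.
have sM : {morph s : x y / x * y}.
  move=> x y; have [Sx xE] := sE x; have [Sy yE] := sE y; have [Sxy xyE] := sE (x * y).
  by apply: uniqS => //; [apply: SM|rewrite gmulfM xyE xE yE].
pose m := isMultiplicative.Build (subgroup_type B') (autg G) s sM.
pose s' : {multiplicative subgroup_type B' -> autg G} := HB.pack s m.
exists B', s'; split; last by move=> b; have [_] := sE b.
have /choice[nf nfE] (f : autg G) : exists f1 : autg G,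
    Out_proj G f1 = Out_proj G f /\ exists m : 'I_N, f1 om = om ^+ m.
  have [m1 [x mx]] := aut_om f; exists (inner x^-1 * f); rewrite Out_proj_inner; split=> //.
  exists (Ordinal (ltn_pmod m1 (ltnW N_gt1))).
  by rewrite -[LHS]/(f om ^ x^-1) mx conjgK powers_mod.
have /choice[ex exE] f : exists m : 'I_N, nf f om = om ^+ m by have [] := nfE f.
pose lt x : G := pi (spell [:: (x, true)]).
have hom_eq (rho sigma : {multiplicative G -> Q}) (f g : autg G) :
    (forall x, rho (f (lt x)) = sigma (g (lt x))) -> forall y, rho (f y) = sigma (g y).
  move=> E y; have [u <-] := pi_surj y.
  exact: (@hom_ext X Q (rho \o (f \o pi)) (sigma \o (g \o pi)) E).
have /choice[R RE] (phi : {ffun X -> Q}) : exists r : G -> Q,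
    forall rho : {multiplicative G -> Q}, (forall x, rho (lt x) = phi x) -> r =1 rho.
  have [[rho rE]|nr] := pselect (exists rho : {multiplicative G -> Q}, forall x, rho (lt x) = phi x).
    by exists rho => sigma sgE; apply: (hom_eq rho sigma 1 1) => x /=; rewrite rE sgE.
  by exists (fun=> 1) => rho rE; case: nr; exists rho.
(* R phi is the homomorphism with values phi at the generators, if there is one. *)
pose code f : 'I_N * {ffun {ffun X -> Q} -> {ffun X -> Q}} :=
  (ex f, [ffun phi => [ffun x => R phi (nf f (lt x))]]).
have codeP f g : code f = code g -> S ((nf f)^-1 * nf g).
  move=> [fg] tab; have fgo : nf f om = nf g om by rewrite !exE fg.
  have rfg (rho : {multiplicative G -> Q}) y : rho (nf f y) = rho (nf g y).
    apply: hom_eq => x; pose phi := [ffun z => rho (lt z)].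
    have Rphi : R phi =1 rho by apply: RE => z; rewrite ffunE.
    by have /ffunP/(_ phi) := tab; rewrite !ffunE => /ffunP/(_ x); rewrite !ffunE !Rphi.
  split=> [|rho y]; first by rewrite /= -fgo aut_funK.
  pose fi : autg G := (nf f)^-1; pose rho' : {multiplicative G -> Q} := rho \o fi.
  by rewrite -[LHS]/(rho' (nf g y)) -rfg /= aut_funK.
pose coset (x : Out G) := [set x * y | y in B].
pose h c := coset (Out_proj G (nf (xget 1 [set f | code f = c]))).
apply: (@sub_finite_set _ _ (h @` setT)); last exact/finite_image/finite_finset.
move=> _ [x _ <-]; have [f fx] := quot_proj_surj x.
exists (code f) => //; rewrite /h; case: xgetP => [g _ gE|/(_ f)/(_ erefl)//].
have Sgf := codeP _ _ gE; rewrite -[x]fx -[quot_proj _ _]/(Out_proj G f).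
rewrite -(nfE f).1 /coset; set z := (nf g)^-1 * nf f in Sgf.
have -> : nf f = nf g * z by rewrite /z mulKVg.
apply/seteqP; split=> _ [_ [s1 Ss1 <-] <-].
  exists (Out_proj G (z^-1 * s1)); first by exists (z^-1 * s1) => //; apply: SM => //; apply: SV.
  by rewrite -!gmulfM -mulgA mulKVg.
exists (Out_proj G (z * s1)); first by exists (z * s1) => //; apply: SM.
by rewrite -!gmulfM mulgA.
Qed.

End Splitting.

Theorem corollary3p4 (G : groupType) (hG : one_relator_with_torsion G) :
  splits_virtually (Out_proj G).
Proof.
case: hG => k [n [R [n1 R1 [f [g fK gK]]]]].
have [w [m [c [w0 m0 wred wprim RE]]]] := root_exists R1.
pose q := quot_proj (ncl [set R ^+ n]).
have gM : {morph g : x y / x * y} by apply: can2_gmulfM fK gK.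
have pM : {morph (fun u => g (q u)) : x y / x * y}.
  by move=> x y; rewrite /q gmulfM gM.
pose pm := isMultiplicative.Build (freeGroup 'I_k) G (fun u => g (q u)) pM.
pose pi : {multiplicative freeGroup 'I_k -> G} :=
  HB.pack (fun u => g (q u)) pm.
have Rn : R ^+ n = (spell w ^+ (m * n)) ^ c by rewrite RE -conjXg -expgM.
have qE u : q u = q 1 <-> normal_closure [set R ^+ n] u.
  split=> [/esym/eqP|N].
    by rewrite quot_projE invg1 mul1g => /set_mem.
  by apply/esym/eqP; rewrite quot_projE invg1 mul1g; apply/mem_set.
have piE u : pi u = 1 <-> normal_closure [set R ^+ n] u.
  rewrite -qE -(hom1 pi); split=> [/(can_inj gK)//|E]; exact: (congr1 g E).
apply: (@Out_splits _ w (m * n) w0 wred wprim _ G pi).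
- by rewrite (leq_trans n1) // leq_pmull.
- by move=> x; have [u uE] := quot_proj_surj (f x); exists u; rewrite /= /q uE fK.
- by move=> u /piE; rewrite Rn; apply: ncl_conj.
rewrite -homX; apply/piE; apply: (@ncl_conj _ _ c^-1).
by rewrite Rn conjgK => M [_]; apply.
Qed.
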